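(* Let $\Gamma$ be one of the groups $\mathbb{Z}_2^{(2)},\mathbb{Z}_2^{(3)},D_4^{(1)},D_4^{(2)},D_6^{(1)},D_6^{(2)},D_8,D_{12}\subset GL(2,\mathbb{Z})$, with fundamental generators $\rho_1,\rho_2$. The joint spectral measure $\varepsilon$ over $\mathbb{T}^2$ for the pair of graphs $(\mathcal{H}^{\Gamma}_{\rho_1},\mathcal{H}^{\Gamma}_{\rho_2})$ is the uniform Lebesgue measure $\mathrm{d}\varepsilon(\omega_1,\omega_2)=\mathrm{d}\omega_1\,\mathrm{d}\omega_2$ (normalized to total mass $1$). That is, this measure satisfies, for all integers $m_1,n_1,m_2,n_2\ge 0$, $$\varphi\big(A_1^{m_1}(A_1^{T})^{n_1}A_2^{m_2}(A_2^{T})^{n_2}\big)=\int_{\mathbb{T}^2}\chi_{\rho_1}(\omega_1,\omega_2)^{m_1}\,\overline{\chi_{\rho_1}(\omega_1,\omega_2)}^{\,n_1}\,\chi_{\rho_2}(\omega_1,\omega_2)^{m_2}\,\overline{\chi_{\rho_2}(\omega_1,\omega_2)}^{\,n_2}\,\mathrm{d}\omega_1\,\mathrm{d}\omega_2,$$ where $A_i$ is the adjacency operator of $\mathcal{H}^{\Gamma}_{\rho_i}$.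
   Context: Groups. Let $T_2=\begin{pmatrix}1&0\\0&-1\end{pmatrix}$, $T_2'=\begin{pmatrix}0&1\\1&0\end{pmatrix}$, $T_3=\begin{pmatrix}0&-1\\1&-1\end{pmatrix}$, $T_4=\begin{pmatrix}0&-1\\1&0\end{pmatrix}$, $T_6=\begin{pmatrix}0&1\\-1&1\end{pmatrix}$. The groups are generated as follows: $\mathbb{Z}_2^{(2)}=\langle T_2\rangle$, $\mathbb{Z}_2^{(3)}=\langle T_2'\rangle$, $D_4^{(1)}=\langle -I,T_2\rangle$, $D_4^{(2)}=\langle -I,T_2'\rangle$, $D_6^{(1)}=\langle T_3,T_2'\rangle$, $D_6^{(2)}=\langle T_3,-T_2'\rangle$, $D_8=\langle T_4,T_2'\rangle$, $D_{12}=\langle T_6,T_2'\rangle$. $\Gamma$ acts on $\theta=(\theta_1,\theta_2)\in\mathbb{R}^2/\mathbb{Z}^2\cong\mathbb{T}^2$ by matrix multiplication and on weights $\lambda\in\mathbb{Z}^2$ by the dual action, $\langle\gamma\cdot\lambda,\theta\rangle=\langle\lambda,\gamma\theta\rangle$. Characters. For $\lambda\in\mathbb{Z}^2$ put $S_\lambda(\theta)=\sum_{\gamma\in\Gamma}\det(\gamma)e^{2\pi i\langle\lambda,\gamma\theta\rangle}$. $P_+$ is the (closed) fundamental domain for $\Gamma$ acting on $\mathbb{Z}^2$ that contains all $(\lambda_1,\lambda_2)$ with $0\le\lambda_2\le\lambda_1$ (the integer points of a closed Weyl chamber), and $P_{++}\subset P_+$ is the set of points not fixed by any non-identity element of $\Gamma$.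 $\varrho$ is the point of $P_{++}$ of smallest Euclidean norm, except that for $\mathbb{Z}_2^{(3)}$ one takes $\varrho=(1,0)$. For $\lambda\in P_+$, with $\omega_j=e^{2\pi i\theta_j}$, $\chi_\lambda(\omega_1,\omega_2)=S_{\lambda+\varrho}(\theta)/S_\varrho(\theta)$, a Laurent polynomial $\chi_\lambda=\sum_\nu p^\lambda_\nu\,\sigma_\nu$ with non-negative integer coefficients, where $\sigma_\nu(\omega_1,\omega_2)=\omega_1^{\nu_1}\omega_2^{\nu_2}$, $\nu\in\mathbb{Z}^2$. Fundamental generators: $\rho_1=(1,0),\rho_2=(0,1)$ for $\mathbb{Z}_2^{(2)},D_4^{(1)},D_6^{(2)}$; $\rho_1=(1,0),\rho_2=(1,1)$ for $\mathbb{Z}_2^{(3)},D_4^{(2)},D_6^{(1)},D_8,D_{12}$. Graphs and state. $\mathcal{H}^\Gamma_{\lambda}$ is the graph with vertex set $\mathbb{Z}^2$ and $n^\lambda_{\mu\nu}$ edges from $\mu$ to $\nu$, where $\chi_\lambda\sigma_\mu=\sum_\nu n^\lambda_{\mu\nu}\sigma_\nu$. Its adjacency operator is the normal operator $\sum_\nu p^\lambda_\nu\, s^{\nu_1}\otimes s^{\nu_2}$ on $\ell^2(\mathbb{Z})\otimes\ell^2(\mathbb{Z})$, with $s$ the bilateral shift; $A^T$ denotes the transpose (equal to the adjoint). $\varphi(\cdot)=\langle\,\cdot\,(\Omega\otimes\Omega),\Omega\otimes\Omega\rangle$ with $\Omega=(\delta_{j,0})_{j\in\mathbb{Z}}$,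 i.e. the vector state of the vertex $(0,0)$. The joint spectral measure of the pair is the unique probability measure on the joint spectrum with the cross moments $\varphi(A_1^{m_1}(A_1^T)^{n_1}A_2^{m_2}(A_2^T)^{n_2})$; a joint spectral measure over $\mathbb{T}^2$ is a $\Gamma$-invariant probability measure on $\mathbb{T}^2$ whose push-forward under $(\omega_1,\omega_2)\mapsto(\chi_{\rho_1},\chi_{\rho_2})$ is that measure. $\mathrm{d}\omega$ is normalized Haar measure on $\mathbb{T}$: $\int_{\mathbb{T}}f(\omega)\mathrm{d}\omega=\int_0^1f(e^{2\pi i\theta})\mathrm{d}\theta$. *)

(* Defs.v *)
From HB Require Import structures.
From mathcomp Require Import all_boot all_order all_algebra finmap complex.
From mathcomp Require Import ring lra.
From mathcomp Require Import all_classical all_reals all_analysis measurable_realfun.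

Set Implicit Arguments.
Unset Strict Implicit.
Unset Printing Implicit Defensive.

Import Order.TTheory GRing.Theory Num.Theory.
Import numFieldNormedType.Exports Normc.

Local Open Scope classical_set_scope.
Local Open Scope complex_scope.
Local Open Scope ring_scope.

(* Weights are row vectors, angles are column vectors: the pairing is        *)
(* <lambda, theta> = lambda *m theta, so the dual action of gamma on weights *)
(* is lambda |-> lambda *m gamma.                                            *)
Notation weight := 'rV[int]_2.

Definition wt (a b : int) : weight := \row_(j < 2) (if j == 0 then a else b).

Definition mx2 (a b c d : int) : 'M[int]_2 :=
  \matrix_(i < 2, j < 2)
    (if i == 0 then (if j == 0 then a else b) else (if j == 0 then c else d)).

Inductive group_name :=
  | Z2_2 | Z2_3 | D4_1 | D4_2 | D6_1 | D6_2 | D8 | D12.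

Definition T2 := mx2 1 0 0 (-1).
Definition T2' := mx2 0 1 1 0.
Definition T3 := mx2 0 (-1) 1 (-1).
Definition T4 := mx2 0 (-1) 1 0.
Definition T6 := mx2 0 1 (-1) 1.

Definition generators (G : group_name) : set 'M[int]_2 :=
  match G with
  | Z2_2 => [set T2]
  | Z2_3 => [set T2']
  | D4_1 => [set -1; T2]
  | D4_2 => [set -1; T2']
  | D6_1 => [set T3; T2']
  | D6_2 => [set T3; - T2']
  | D8 => [set T4; T2']
  | D12 => [set T6; T2']
  end.

Definition GL2Z_subgroup (H : set 'M[int]_2) : Prop :=
  [/\ H `<=` [set g | g \is a GRing.unit], H 1,
      forall g h, H g -> H h -> H (g * h) & forall g, H g -> H g^-1].

Definition Gamma (G : group_name) : set 'M[int]_2 :=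
  smallest GL2Z_subgroup (generators G).

Definition wdot (l m : weight) : int := \sum_j l 0 j * m 0 j.

(* For a reflection g (the elements of determinant -1), l - l *m g is the    *)
(* component of l along the (-1)-eigenline of g.  Hence 0 <= wdot (l - l *m g)*)
(* (m - m *m g) says that l and m are on the same closed side of the mirror  *)
(* of g.  P_plus is thus the set of integer points of the closed chamber cut *)
(* out by the mirrors of Gamma that contains the wedge 0 <= m2 <= m1.        *)
Definition P_plus (G : group_name) : set weight :=
  [set l | forall g (m : weight),
     Gamma G g -> \det g = -1 -> 0 <= m 0 1 <= m 0 0 ->
     0 <= wdot (l - l *m g) (m - m *m g)].

Definition P_pplus (G : group_name) : set weight :=
  [set l | P_plus G l /\ forall g, Gamma G g -> l *m g = l -> g = 1].

(* The minimizer is unique in the cases where xget is used. *)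
Definition varrho (G : group_name) : weight :=
  match G with
  | Z2_3 => wt 1 0
  | _ => xget 0 [set r | P_pplus G r /\
                  forall l, P_pplus G l -> wdot r r <= wdot l l]
  end.

Definition rho1 (G : group_name) : weight := wt 1 0.

Definition rho2 (G : group_name) : weight :=
  match G with
  | Z2_2 | D4_1 | D6_2 => wt 0 1
  | Z2_3 | D4_2 | D6_1 | D8 | D12 => wt 1 1
  end.

Notation laurent := {fsfun weight -> nat with 0%N}.

Definition sigma (mu : weight) : laurent :=
  [fsfun [fsfun] with mu |-> 1%N].

Definition lmul (p q : laurent) (nu : weight) : nat :=
  (\sum_(kappa <- finsupp p) p kappa * q (nu - kappa)%R)%N.

Section Complex.
Variable R : realType.
Local Notation C := R[i].

Definition leval (p : laurent) (w : C * C) : C :=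
  \sum_(nu <- finsupp p) (p nu)%:R * (w.1 ^ nu 0 0 * w.2 ^ nu 0 1).

Definition expi2pi (t : R) : C := cos (2 * pi * t) +i* sin (2 * pi * t).

Definition pairing (l : weight) (theta : 'cV[R]_2) : R :=
  (map_mx intr l *m theta) 0 0.

Definition alt_sum (G : group_name) (l : weight) (theta : 'cV[R]_2) : C :=
  \sum_(g \in Gamma G)
    (\det g)%:~R * expi2pi (pairing l (map_mx intr g *m theta)).

Definition is_chi (G : group_name) (l : weight) (p : laurent) : Prop :=
  forall theta : 'cV[R]_2, alt_sum G (varrho G) theta != 0 ->
    leval p (expi2pi (theta 0 0), expi2pi (theta 1 0)) =
    alt_sum G (l + varrho G) theta / alt_sum G (varrho G) theta.

(* The quotient determines p, as alt_sum G (varrho G) is nonzero on a dense   *)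
(* set of angles.                                                             *)
Definition chi (G : group_name) (l : weight) : laurent :=
  xget [fsfun] [set p | is_chi G l p].

Definition edges (G : group_name) (l mu nu : weight) : nat :=
  lmul (chi G l) (sigma mu) nu.

Definition is_l2 (x : weight -> C) : Prop :=
  (\esum_(mu in setT) (normc (x mu) ^+ 2)%:E < +oo)%E.

Definition l2_pred : {pred (weight -> C)} := fun x => `[< is_l2 x >].

Lemma normcD_sq (a b : C) :
  normc (a + b) ^+ 2 <= 2 * normc a ^+ 2 + 2 * normc b ^+ 2.
Proof.
case: a b => [a1 a2] [b1 b2] /=.
rewrite !sqr_sqrtr ?addr_ge0 ?sqr_ge0 //.
have := sqr_ge0 (a1 - b1); have := sqr_ge0 (a2 - b2); nra.
Qed.

Lemma l2_submod_closed : submod_closed l2_pred.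
Proof.
have ge0 (z : C) : (0 <= (normc z ^+ 2)%:E :> \bar R)%E by rewrite lee_fin sqr_ge0.
have fin k (z : weight -> C) : 0 <= k ->
    (\esum_(mu in setT) (normc (z mu) ^+ 2)%:E < +oo)%E ->
    (\esum_(mu in setT) (k%:E * (normc (z mu) ^+ 2)%:E) < +oo)%E.
  move=> k0 lz; apply: (@le_lt_trans _ _
    (k%:E * \esum_(mu in setT) (normc (z mu) ^+ 2)%:E)%E).
    apply: ub_ereal_sup => _ [X [finX _] <-].
    rewrite -ge0_mule_fsumr //; apply: lee_wpmul2l; first by rewrite lee_fin.
    by apply: ereal_sup_ubound; exists X.
  by rewrite lte_mul_pinfty // lee_fin.
split.
  apply/asboolP; rewrite /is_l2 esum1 // => mu _.
  by rewrite normc0 expr0n.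
move=> a x y /asboolP lx /asboolP ly; apply/asboolP; rewrite /is_l2.
apply: (@le_lt_trans _ _ (\esum_(mu in setT)
  ((2 * normc a ^+ 2)%:E * (normc (x mu) ^+ 2)%:E + 2%:E * (normc (y mu) ^+ 2)%:E))%E).
  apply: le_esum => mu _; rewrite -!EFinM -EFinD lee_fin.
  by rewrite (le_trans (normcD_sq _ _)) // normcM exprMn mulrA.
rewrite esumD.
- apply: lte_add_pinfty; first by apply: fin lx; rewrite mulr_ge0 ?sqr_ge0.
  by apply: fin ly.
- by move=> mu _; rewrite mule_ge0 // lee_fin mulr_ge0 ?sqr_ge0.
- by move=> mu _; rewrite mule_ge0.
Qed.

HB.instance Definition _ :=
  GRing.isSubmodClosed.Build C (weight -> C) l2_pred l2_submod_closed.

Record l2 := L2 { l2_fun :> weight -> C ; l2_funP : l2_fun \in l2_pred }.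

HB.instance Definition _ := [isSub for l2_fun].
HB.instance Definition _ := [Choice of l2 by <:].
HB.instance Definition _ := [SubChoice_isSubLmodule of l2 by <:].

Definition l2norm (x : l2) : R :=
  Num.sqrt (fine (\esum_(mu in setT) (normc (x mu) ^+ 2)%:E)).

(* rsum and csum are only meaningful on absolutely summable families. *)
Definition rsum (f : weight -> R) : R :=
  fine (\esum_(mu in setT) ((EFin \o f)^\+ mu)%E) -
  fine (\esum_(mu in setT) ((EFin \o f)^\- mu)%E).

Definition csum (f : weight -> C) : C :=
  rsum (fun mu => complex.Re (f mu)) +i* rsum (fun mu => complex.Im (f mu)).

Definition inner (x y : l2) : C := csum (fun mu => x mu * conjc (y mu)).

Definition Omega (j : int) : C := (j == 0)%:R.

Lemma vacuum_subproof :
  (fun mu : weight => Omega (mu 0 0) * Omega (mu 0 1)) \in l2_pred.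
Proof.
apply/asboolP; rewrite /is_l2.
rewrite (eq_esum (b := fun mu => if mu \in [set 0] then 1%E else 0%E)).
  by rewrite -esum_mkcond esum_set1 // ltry.
move=> mu _; have -> : (mu \in [set 0]) = (mu 0 0 == 0) && (mu 0 1 == 0).
  apply/idP/andP => [|[/eqP h0 /eqP h1]]; first by rewrite inE => ->; rewrite !mxE.
  rewrite inE; apply/rowP => j; rewrite mxE.
  by have [->|->] : j = 0 \/ j = 1
    by case: j => -[|[|//]] ?; [left|right]; apply: val_inj.
by rewrite /Omega; do 2 case: eqP => _;
  rewrite ?(mulr0, mul0r, mulr1, normc0, normc1, expr0n, expr1n).
Qed.

Definition vacuum : l2 := L2 vacuum_subproof.

Definition phi (T : l2 -> l2) : C := inner (T vacuum) vacuum.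

(* The operator sending delta_mu to the sum of the n mu nu delta_nu, for a    *)
(* graph with n mu nu edges from mu to nu; the default 0 of insubd is not     *)
(* reached for the graphs of interest, see adjacencyE and adjacency_trE.      *)
Definition adjacency (n : weight -> weight -> nat) (x : l2) : l2 :=
  insubd 0 (fun nu => \sum_(mu \in [set: weight]) (n mu nu)%:R * x mu).

Definition transpose (n : weight -> weight -> nat) : weight -> weight -> nat :=
  fun mu nu => n nu mu.

(* shift kappa = s^kappa_1 (x) s^kappa_2, with s delta_j = delta_(j+1). *)
Lemma shift_subproof (kappa : weight) (x : l2) :
  (fun nu => x (nu - kappa)) \in l2_pred.
Proof.
apply/asboolP; rewrite /is_l2.
have := l2_funP x => /asboolP; rewrite /is_l2.
rewrite (@reindex_esum _ _ _ setT setT (fun nu => nu - kappa)) //.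
split => // [mu nu _ _ /addIr //|mu _ /=].
by exists (mu + kappa) => //; rewrite addrK.
Qed.

Definition shift (kappa : weight) (x : l2) : l2 := L2 (shift_subproof kappa x).

Lemma edgesE G l mu nu : edges G l mu nu = chi G l (nu - mu).
Proof.
rewrite /edges /lmul; set p := chi G l.
have sE kappa : sigma mu (nu - kappa) = (kappa == nu - mu) :> nat.
  have -> : (kappa == nu - mu) = (nu - kappa == mu).
    by apply/eqP/eqP => [->|<-]; rewrite subKr.
  by rewrite fsfun_withE fsfunE; case: eqP.
under eq_bigr do rewrite sE.
have [np|np] := boolP (nu - mu \in finsupp p).
  rewrite (bigD1_seq (nu - mu)) ?fset_uniq //=.
  rewrite (_ : (_ == _) = true) ?muln1; last exact/eqP.
  rewrite big1 ?addn0 // => k kn; rewrite (_ : (_ == _) = false) ?muln0 //.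
  exact: negbTE.
rewrite big_seq big1 ?fsfun_dflt // => k kp.
by rewrite (_ : (_ == _) = false) ?muln0 //; apply: contraNF np => /eqP <-.
Qed.

Lemma l2_sumE (I : Type) (s : seq I) (F : I -> l2) nu :
  (\sum_(i <- s) F i) nu = \sum_(i <- s) F i nu.
Proof. by elim/big_ind2: _ => // x1 x2 y1 y2 <- <-. Qed.

Lemma fsbig_laurent (p : laurent) (x : l2) (h h' : weight -> weight) :
  cancel h h' -> cancel h' h ->
  \sum_(mu \in [set: weight]) (p (h mu))%:R * x mu =
  \sum_(kappa <- finsupp p) (p kappa)%:R * x (h' kappa).
Proof.
move=> hK h'K; rewrite (reindex_fsbigT h'); last by exists h.
rewrite (fsbigE (finsupp p)) //=; last first.
  by move=> k _ kp; rewrite h'K fsfun_dflt // mul0r.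
by rewrite big_mkcond; apply: eq_bigr => k _; rewrite in_setT h'K.
Qed.

Lemma adjacencyE G l x : adjacency (edges G l) x =
  \sum_(kappa <- finsupp (chi G l)) (chi G l kappa)%:R *: shift kappa x.
Proof.
rewrite /adjacency -[RHS](valKd 0); congr insubd; apply/funext => nu.
rewrite [RHS]l2_sumE; under eq_fsbigr do rewrite edgesE.
by rewrite (fsbig_laurent _ _ (h' := fun kappa => nu - kappa)) //;
  move=> kappa; rewrite subKr.
Qed.

Lemma adjacency_trE G l x : adjacency (transpose (edges G l)) x =
  \sum_(kappa <- finsupp (chi G l)) (chi G l kappa)%:R *: shift (- kappa) x.
Proof.
rewrite /adjacency -[RHS](valKd 0); congr insubd; apply/funext => nu.
rewrite [RHS]l2_sumE; under eq_fsbigr do rewrite /transpose edgesE.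
rewrite (fsbig_laurent _ _ (h' := fun kappa => kappa + nu));
  [|exact: subrK|exact: addrK].
by apply: eq_bigr => kappa _; rewrite /= opprK addrC.
Qed.

Definition is_bounded_op (T : l2 -> l2) : Prop :=
  linear T /\ exists M, forall x, l2norm (T x) <= M * l2norm x.

Definition is_adjoint (T T' : l2 -> l2) : Prop :=
  forall x y, inner (T x) y = inner x (T' y).

Definition closed_operator_algebra (A : set (l2 -> l2)) : Prop :=
  [/\ A id,
      forall a S T, A S -> A T -> A (fun x => a *: S x + T x),
      forall S T, A S -> A T -> A (S \o T) &
      forall T, is_bounded_op T ->
        (forall e, 0 < e -> exists S, A S /\
           forall x, l2norm (T x - S x) <= e * l2norm x) ->
        A T].

(* The C*-algebra generated by a family of operators: the unital norm-closed  *)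
(* algebra generated by the operators and their adjoints.                     *)
Definition cstar_algebra (F : set (l2 -> l2)) : set (l2 -> l2) :=
  smallest closed_operator_algebra
    [set T | F T \/ exists2 S, F S & is_adjoint S T].

Definition is_algebra_character (A : set (l2 -> l2)) (x : (l2 -> l2) -> C) :=
  [/\ x id = 1,
      forall a S T, A S -> A T -> x (fun v => a *: S v + T v) = a * x S + x T &
      forall S T, A S -> A T -> x (S \o T) = x S * x T].

Definition joint_spectrum (A1 A2 : l2 -> l2) : set (C * C) :=
  [set z | exists x, is_algebra_character (cstar_algebra [set A1; A2]) x /\
                     z = (x A1, x A2)].

HB.instance Definition _ := isPointed.Build C 0.

(* The Borel sigma-algebra of C, identified with R * R. *)
Definition measurable_complex : set (set C) :=
  [set A | measurable [set p : R * R | A (p.1 +i* p.2)]].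

Lemma measurable_complex0 : measurable_complex set0.
Proof. exact: measurable0. Qed.

Lemma measurable_complexC A : measurable_complex A -> measurable_complex (~` A).
Proof. exact: measurableC. Qed.

Lemma measurable_complex_bigcup (F : (set C)^nat) :
  (forall i, measurable_complex (F i)) -> measurable_complex (\bigcup_i F i).
Proof. by move=> mF; exact: (bigcup_measurable (fun k _ => mF k)). Qed.

HB.instance Definition _ := @isMeasurable.Build default_measure_display C
  measurable_complex measurable_complex0 measurable_complexC
  measurable_complex_bigcup.

Lemma measurable_expi2pi : measurable_fun [set: R] expi2pi.
Proof.
have mcomp (f : R -> R) : continuous f ->
    measurable_fun [set: R] (fun t => f (2 * pi * t)).
  move=> cf; apply: continuous_measurable_fun => t.
  by apply: continuous_comp; [exact: mulrl_continuous|exact: cf].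
have mf := measurable_fun_pair (mcomp _ (@continuous_cos R))
                               (mcomp _ (@continuous_sin R)).
by move=> _ A mA; exact: (mf measurableT _ mA).
Qed.

Definition circle_map : {mfun measurableTypeR R >-> C} :=
  HB.pack expi2pi
    (@isMeasurableFun.Build _ _ (measurableTypeR R) C expi2pi measurable_expi2pi).

(* Haar measure of the unit circle as a measure on C, i.e. the image of the   *)
(* uniform measure of [0, 1] under t |-> exp (2 i pi t).                      *)
Definition haar : probability C R :=
  distribution (uniform_prob (@ltr01 R)) circle_map.

Definition haar2 : probability (C * C)%type R := (haar \x haar)%E.

Definition torus : set (C * C) := [set w | normc w.1 = 1 /\ normc w.2 = 1].

(* The action theta |-> g *m theta of Gamma, read on (omega_1, omega_2).      *)
Definition act (g : 'M[int]_2) (w : C * C) : C * C :=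
  (w.1 ^ g 0 0 * w.2 ^ g 0 1, w.1 ^ g 1 0 * w.2 ^ g 1 1).

Definition cintegral (mu : probability (C * C)%type R) (f : C * C -> C) : C :=
  Rintegral mu setT (fun w => complex.Re (f w)) +i*
  Rintegral mu setT (fun w => complex.Im (f w)).

Definition cross_moment (e1 e2 : weight -> weight -> nat)
    (m1 n1 m2 n2 : nat) : C :=
  phi (iter m1 (adjacency e1) \o iter n1 (adjacency (transpose e1)) \o
       iter m2 (adjacency e2) \o iter n2 (adjacency (transpose e2))).

Definition monomial (m1 n1 m2 n2 : nat) (z : C * C) : C :=
  z.1 ^+ m1 * conjc z.1 ^+ n1 * z.2 ^+ m2 * conjc z.2 ^+ n2.

(* The joint spectrum is compact, hence measurable. *)
Definition is_joint_spectral_measure (e1 e2 : weight -> weight -> nat)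
    (mu : probability (C * C)%type R) : Prop :=
  mu (joint_spectrum (adjacency e1) (adjacency e2)) = 1%E /\
  forall m1 n1 m2 n2,
    cintegral mu (monomial m1 n1 m2 n2) = cross_moment e1 e2 m1 n1 m2 n2.

Definition chi_pair (G : group_name) (w : C * C) : C * C :=
  (leval (chi G (rho1 G)) w, leval (chi G (rho2 G)) w).

Definition is_joint_spectral_measure_over_torus (G : group_name)
    (eps : probability (C * C)%type R) : Prop :=
  [/\ eps torus = 1%E,
      forall g, Gamma G g -> forall B, measurable B ->
        eps (act g @^-1` B) = eps B &
      exists mu : probability (C * C)%type R,
        is_joint_spectral_measure
          (edges G (rho1 G)) (edges G (rho2 G)) mu /\
        forall B, measurable B -> mu B = eps (chi_pair G @^-1` B)].

End Complex.

(* Main.v *)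
Require Import Defs.
From HB Require Import structures.
From mathcomp Require Import all_boot all_order all_algebra finmap complex.
From mathcomp Require Import ring lra.
From mathcomp Require Import all_classical all_reals all_analysis measurable_realfun.

Set Implicit Arguments.
Unset Strict Implicit.
Unset Printing Implicit Defensive.

Import Order.TTheory GRing.Theory Num.Theory.
Import numFieldNormedType.Exports Normc.

Local Open Scope classical_set_scope.
Local Open Scope complex_scope.
Local Open Scope ring_scope.

(* The graphs have vertex set Z^2 and translation-invariant edges, so a word  *)
(* in the adjacency operators and their transposes sends the vacuum to a      *)
(* finitely supported vector, namely the Fourier coefficients of the          *)
(* corresponding product of values of the chi; its coefficient at the origin  *)
(* is the Haar integral of that product.  Only the fact that the chi are      *)
(* Laurent polynomials matters, not which ones they are.                      *)
(*   Haar measure is the only rotation-invariant probability on the torus, as *)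
(* averaging one such measure against another shows (Fubini); hence it is     *)
(* invariant under the automorphisms of the torus given by GL(2, Z).          *)
(*   A point w of the torus yields approximate eigenvectors: a plane wave of  *)
(* frequency w, cut off to a box of side n, has norm n, and a unit shift      *)
(* changes it, up to a phase, only at the boundary of the box, hence by       *)
(* O(sqrt n).  The bounded operators having these vectors as approximate      *)
(* eigenvectors form a closed algebra, on which the eigenvalue is a           *)
(* character, so (chi_rho1(w), chi_rho2(w)) is in the joint spectrum.         *)

(** Fourier series identify the square-summable functions on Z^2 with square-integrable functions on
    the torus. The adjacency operator of a graph becomes multiplication by its chi, the transpose
    multiplication by the conjugate of chi, and the vacuum the constant 1. The moment formula
    [cross_momentE] thus reads off a constant Fourier coefficient. [symbol] records the
    correspondence, [symbol_adjacency] and [symbol_adjacency_tr] carry it along a word of operators,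
    and [symbol_cintegral] evaluates it through the orthogonality of characters,
    [cintegral_trig_sum].

    The measure on the joint spectrum is the image of Haar measure under [chi_pair]. Its moments
    follow by change of variables ([cintegral_image]). It gives the joint spectrum mass 1 because
    [joint_spectrum_chi_pair] places the image of every torus point there. That lemma uses the
    vectors [box_vector]; [approx_eigenvalue_limit] and [adjacency_adjoint] account for norm limits
    and adjoints in the C*-algebra. Invariance under Gamma is [haar2_act], a consequence of the
    uniqueness result [haar2_unique]. *)

Section ComplexMeasurable.
Context {R : realType} d (T : measurableType d).
Local Notation C := R[i].
Implicit Types f g : T -> C.

Lemma measurable_complex_mk (u v : T -> R) :
  measurable_fun setT u -> measurable_fun setT v ->
  measurable_fun setT (fun x => u x +i* v x : C).
Proof.
move=> mu mv _ A mA.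
have := measurable_fun_pair mu mv measurableT mA.
exact.
Qed.

Lemma measurable_Re : measurable_fun setT (@complex.Re R : C -> R).
Proof.
move=> _ A mA; rewrite setTI.
have : measurable_fun [set: R * R] (fst : R * R -> R) by exact: measurable_fst.
by move=> /(_ measurableT _ mA); rewrite setTI.
Qed.

Lemma measurable_Im : measurable_fun setT (@complex.Im R : C -> R).
Proof.
move=> _ A mA; rewrite setTI.
have : measurable_fun [set: R * R] (snd : R * R -> R) by exact: measurable_snd.
by move=> /(_ measurableT _ mA); rewrite setTI.
Qed.

Lemma measurable_ReT f : measurable_fun setT f ->
  measurable_fun setT (fun x => complex.Re (f x)).
Proof. by move=> mf; apply: (measurableT_comp measurable_Re mf). Qed.

Lemma measurable_ImT f : measurable_fun setT f ->
  measurable_fun setT (fun x => complex.Im (f x)).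
Proof. by move=> mf; apply: (measurableT_comp measurable_Im mf). Qed.

Lemma measurable_complexE f :
  measurable_fun setT (fun x => complex.Re (f x)) ->
  measurable_fun setT (fun x => complex.Im (f x)) -> measurable_fun setT f.
Proof.
move=> mr mi; have := measurable_complex_mk mr mi.
by congr measurable_fun; apply/funext => x; case: (f x).
Qed.

Lemma measurable_complexD f g : measurable_fun setT f ->
  measurable_fun setT g -> measurable_fun setT (fun x => f x + g x).
Proof.
move=> mf mg; apply: measurable_complexE.
  rewrite (_ : (fun _ => _) = (fun x => complex.Re (f x) + complex.Re (g x))).
    by apply: measurable_funD; exact: measurable_ReT.
  by apply/funext => x; case: (f x) (g x) => [? ?] [].
rewrite (_ : (fun _ => _) = (fun x => complex.Im (f x) + complex.Im (g x))).
  by apply: measurable_funD; exact: measurable_ImT.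
by apply/funext => x; case: (f x) (g x) => [? ?] [].
Qed.

Lemma measurable_complexM f g : measurable_fun setT f ->
  measurable_fun setT g -> measurable_fun setT (fun x => f x * g x).
Proof.
move=> mf mg; apply: measurable_complexE.
  rewrite (_ : (fun _ => _) = (fun x => complex.Re (f x) * complex.Re (g x) -
    complex.Im (f x) * complex.Im (g x))).
    apply: measurable_funB; apply: measurable_funM;
      by [exact: measurable_ReT|exact: measurable_ImT].
  by apply/funext => x; case: (f x) (g x) => [? ?] [].
rewrite (_ : (fun _ => _) = (fun x => complex.Re (f x) * complex.Im (g x) +
    complex.Im (f x) * complex.Re (g x))).
  apply: measurable_funD; apply: measurable_funM;
    by [exact: measurable_ReT|exact: measurable_ImT].
by apply/funext => x; case: (f x) (g x) => [? ?] [].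
Qed.

Lemma measurable_complexX f n : measurable_fun setT f ->
  measurable_fun setT (fun x => f x ^+ n).
Proof.
move=> mf; elim: n => [|n IH]; first exact: measurable_cst.
by under eq_fun do rewrite exprS; exact: measurable_complexM.
Qed.

Lemma measurable_conjc f : measurable_fun setT f ->
  measurable_fun setT (fun x => conjc (f x)).
Proof.
move=> mf; apply: measurable_complexE.
  rewrite (_ : (fun _ => _) = (fun x => complex.Re (f x))).
    exact: measurable_ReT.
  by apply/funext => x; case: (f x).
rewrite (_ : (fun _ => _) = (fun x => - complex.Im (f x))).
  by apply: measurableT_comp => //; exact: measurable_ImT.
by apply/funext => x; case: (f x).
Qed.

(** Inversion is continuous on the open complement of 0, and any function is measurable on the
    remaining singleton. *)
Lemma measurable_invr : measurable_fun [set: R] (GRing.inv : R -> R).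
Proof.
rewrite -(setvU [set 0 : R]); apply/measurable_funU => //.
  exact: measurableC.
split; last exact: measurable_fun_set1.
apply: open_continuous_measurable_fun; first by apply: closed_openC;
  exact: closed_eq.
by move=> x; rewrite inE => /eqP x0; exact: inv_continuous.
Qed.

Lemma measurable_complexV f : measurable_fun setT f ->
  measurable_fun setT (fun x => (f x)^-1).
Proof.
move=> mf.
have mN : measurable_fun setT
    (fun x => (complex.Re (f x) ^+ 2 + complex.Im (f x) ^+ 2)^-1).
  apply: (measurableT_comp measurable_invr).
  by apply: measurable_funD; apply: measurable_funX;
    [exact: measurable_ReT|exact: measurable_ImT].
apply: measurable_complexE.
  rewrite (_ : (fun _ => _) = (fun x => complex.Re (f x) *
     (complex.Re (f x) ^+ 2 + complex.Im (f x) ^+ 2)^-1)).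
    by apply: measurable_funM => //; exact: measurable_ReT.
  by apply/funext => x; case: (f x).
rewrite (_ : (fun _ => _) = (fun x => - (complex.Im (f x) *
     (complex.Re (f x) ^+ 2 + complex.Im (f x) ^+ 2)^-1))).
  apply: measurableT_comp => //.
  by apply: measurable_funM => //; exact: measurable_ImT.
by apply/funext => x; case: (f x) => a b /=; rewrite ?mulNr.
Qed.

Lemma measurable_complex_exprz f (n : int) : measurable_fun setT f ->
  measurable_fun setT (fun x => f x ^ n).
Proof.
move=> mf; case: n => n; first exact: measurable_complexX.
by apply: measurable_complexV; exact: measurable_complexX.
Qed.

End ComplexMeasurable.

(** * The unit circle and its parametrization by angles *)

Section Circle.
Context {R : realType}.
Local Notation C := R[i].

Definition circle : set C := [set z | normc z = 1].

Lemma circleP (z : C) :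
  circle z <-> complex.Re z ^+ 2 + complex.Im z ^+ 2 = 1.
Proof.
case: z => a b; rewrite /circle /=; split => [/(congr1 (fun x => x ^+ 2))|->].
  by rewrite sqr_sqrtr ?addr_ge0 ?sqr_ge0// expr1n.
exact: sqrtr1.
Qed.

Lemma circle1 : circle 1.
Proof. exact: normc1. Qed.

Lemma circleM z w : circle z -> circle w -> circle (z * w).
Proof. by rewrite /circle /= normcM => -> ->; rewrite mulr1. Qed.

Lemma circleV z : circle z -> circle z^-1.
Proof. by rewrite /circle /= normcV => ->; rewrite invr1. Qed.

Lemma circle_exprz z (n : int) : circle z -> circle (z ^ n).
Proof.
move=> cz; case: n => n; last apply: circleV.
  by rewrite -exprnP; elim: n => [|n IH];
    [exact: circle1|rewrite exprS; exact: circleM].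
by elim: n.+1 => [|k IH]; [exact: circle1|rewrite exprS; exact: circleM].
Qed.

Lemma circle_neq0 z : circle z -> z != 0.
Proof.
move=> cz; apply/eqP => z0; move: cz;
  rewrite z0 /circle /= expr0n/= addr0 sqrtr0.
by move/eqP; rewrite eq_sym oner_eq0.
Qed.

Lemma circle_conj z : circle z -> conjc z = z^-1.
Proof.
by case: z => a b /circleP /= ab; rewrite /GRing.inv /= ab !divr1.
Qed.

Lemma measurable_circle : measurable circle.
Proof.
rewrite (_ : circle = (fun z : C => complex.Re z ^+ 2 + complex.Im z ^+ 2)
  @^-1` [set 1]).
  rewrite -[X in measurable X]setTI.
  suff /(_ measurableT) :
    measurable_fun setT (fun z : C => complex.Re z ^+ 2 + complex.Im z ^+ 2)
      by exact.
  by apply: measurable_funD; apply: measurable_funX;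
    [exact: measurable_Re|exact: measurable_Im].
by apply/seteqP; split => z /circleP.
Qed.

Lemma circle_expi2pi (t : R) : circle (expi2pi t).
Proof. by apply/circleP => /=; exact: cos2Dsin2. Qed.

Lemma expi2piD (s t : R) : expi2pi (s + t) = expi2pi s * expi2pi t.
Proof. by rewrite /expi2pi mulrDr cosD sinD; congr (_ +i* _);
  rewrite addrC. Qed.

Lemma expi2pi1 : expi2pi (1 : R) = 1.
Proof. by rewrite /expi2pi mulr1 mulr_natl cos2pi sin2pi. Qed.

Lemma expi2pi_half : expi2pi (2^-1 : R) = - 1.
Proof. 
rewrite /expi2pi mulrAC divff ?mul1r ?pnatr_eq0// cospi sinpi.
by apply/eqP; rewrite eq_complex /= oppr0 !eqxx.
Qed.

(** The arc cosine of the real part gives the angle on the closed upper half circle; on the lower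
    half the angle t is replaced by 1 - t. *)
Lemma expi2pi_surj z : circle z -> exists2 t : R, 0 <= t <= 1 & z = expi2pi t.
Proof.
move=> /circleP; case: z => a b /= ab.
have a1 : -1 <= a <= 1 by nra.
have pi0 : 0 < pi *+ 2 :> R by rewrite pmulrn_lgt0 // pi_gt0.
have b2 : Num.sqrt (1 - a ^+ 2) = `|b| by rewrite -ab addrC addKr sqrtr_sqr.
set t := acos a / (pi *+ 2).
have tE : 2 * pi * t = acos a by rewrite /t mulr_natl mulrC divfK // gt_eqF.
have t01 : 0 <= t <= 1.
  rewrite divr_ge0 ?acos_ge0 ?(ltW pi0)//= ler_pdivrMr// mul1r.
  rewrite (le_trans (acos_lepi a1))// mulr2n lerDl.
  exact/ltW/pi_gt0.
have aI : a \in `[(-1), 1] by rewrite in_itv.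
have [b0|b0] := leP 0 b.
  exists t => //; rewrite /expi2pi tE acosK // sin_acos // b2.
  by rewrite ger0_norm.
exists (1 - t); first by lra.
rewrite expi2piD expi2pi1 mul1r /expi2pi mulrN tE cosN sinN acosK // sin_acos
  // b2.
by rewrite ltr0_norm // opprK.
Qed.

End Circle.

(** * Rotation invariance of Haar measure on the circle *)

Section Rotation.
Context {R : realType}.
Local Notation C := R[i].
Local Notation mu := (@lebesgue_measure R).
Local Open Scope ereal_scope.

Lemma lebesgue_measure_translate (a : R) (A : set R) : measurable A ->
  mu ((fun x => x + a)%R @^-1` A) = mu A.
Proof.
move=> mA.
have mf : measurable_fun [set: measurableTypeR R]
  (fun x : measurableTypeR R => x + a : measurableTypeR R)%R.
  exact: measurable_funD.
pose f : {mfun measurableTypeR R >-> measurableTypeR R} :=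
  HB.pack (fun x => x + a)%R (@isMeasurableFun.Build _ _ _ _ _ mf).
suff /(_ _ mA) : forall A, measurable A -> mu A = pushforward mu f A
  by move=> ->.
apply: lebesgue_measure_unique => _ [[x y]] _ <-.
rewrite /pushforward /=.
rewrite [X in _ = mu X](_ : _ = `](x - a)%R, (y - a)%R]%classic).
  by rewrite !lebesgue_measure_itv/= !lte_fin ltrD2r -!EFinB opprB addrA addrNK.
by apply/seteqP; split => t /=; rewrite !in_itv /= ltrBlDr lerBrDr.
Qed.

(** Dropping the null endpoint 1 makes the interval half-open, so that its translates can be cut
    into disjoint pieces of the same kind. *)
Lemma uniform01E (A : set R) : measurable A ->
  uniform_prob (@ltr01 R) A = mu (A `&` `[0%R, 1%R[).
Proof.
move=> mA; rewrite /uniform_prob integral_uniform_pdf.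
rewrite (eq_integral (cst 1)); last first.
  move=> x; rewrite inE => -[_] /=; rewrite in_itv /= /uniform_pdf => ->.
  by rewrite subr0 invr1.
rewrite integral_cst ?mul1e; last exact: measurableI.
have -> : `[0%R, 1%R]%classic = `[0%R, 1%R[ `|` [set 1%R] :> set R.
  by rewrite setUitv1 // bnd_simp ler01.
rewrite setIUr; apply/eqP; rewrite eq_le; apply/andP; split.
  apply: le_trans (measureU2 _ _ _) _ => //;
    [exact: measurableI|exact: measurableI|].
  rewrite -[leRHS]adde0 leeD2l// -(lebesgue_measure_set1 1%R).
  by apply: le_measure; rewrite ?inE//; exact: measurableI.
apply: le_measure; rewrite ?inE; [exact: measurableI| |by apply: subsetUl].
by apply: measurableU; exact: measurableI.
Qed.

Lemma haar_rotation (z : C) (B : set C) : circle z -> measurable B ->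
  haar R ( *%R z @^-1` B) = haar R B.
Proof.
move=> /expi2pi_surj[a /andP[a0 a1] ->] mB.
rewrite /haar /distribution /pushforward /=.
pose A := @expi2pi R @^-1` B.
have mA : measurable A.
  rewrite -[X in measurable X]setTI; exact: (measurable_expi2pi measurableT mB).
have AD1 t : A (t + 1)%R <-> A t by rewrite /A /= expi2piD expi2pi1 mulr1.
have -> : (@expi2pi R @^-1` ( *%R (expi2pi a) @^-1` B)) =
  (fun t => t + a)%R @^-1` A.
  by apply/seteqP; split => t /=; rewrite /A /= expi2piD mulrC.
have mt (b : R) (D : set R) : measurable D ->
  measurable ((fun t => t + b)%R @^-1` D).
  move=> mD; rewrite -[X in measurable X]setTI.
  have : measurable_fun [set: measurableTypeR R]
    (fun x : measurableTypeR R => x + b : measurableTypeR R)%R.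
    exact: measurable_funD.
  by move=> /(_ measurableT _ mD).
have trI (b x y : R) : mu ((fun t => t + b)%R @^-1` A `&` `[x, y[) =
    mu (A `&` `[(x + b)%R, (y + b)%R[).
  rewrite -[RHS](lebesgue_measure_translate b); last exact: measurableI.
  by congr (mu (_ `&` _)); apply/seteqP; split => t /=;
    rewrite !in_itv /= lerD2r ltrD2r.
rewrite !uniform01E //; last exact: mt.
rewrite trI add0r.
have split3 (x y w : R) : (x <= y)%R -> (y <= w)%R ->
    mu (A `&` `[x, w[) = mu (A `&` `[x, y[) + mu (A `&` `[y, w[).
  move=> xy yw; rewrite -measureU; last 3 first.
  - exact: measurableI.
  - exact: measurableI.
  - apply/seteqP; split => // t [[_ t1] [_ t2]]; move: t1 t2;
      rewrite /= !in_itv /=.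
    by move=> /andP[_ ty] /andP[/(lt_le_trans ty)]; rewrite ltxx.
  rewrite -setIUr; congr (mu (_ `&` _)).
  by apply: itv_bndbnd_setU; rewrite bnd_simp.
(* The rotated set is measured on [a, 1 + a), cut here at 1, while [0, 1) is cut at a. The piece [a,
   1) is common, and [1, 1 + a) is [0, a) moved by the period 1 of [A]. *)
rewrite (split3 a 1%R) //; last by rewrite lerDl.
rewrite (split3 0%R a 1%R) // addeC; congr (_ + _).
rewrite -[X in `[X, _[]add0r -[X in `[_, X[]addrC -trI.
by congr (mu (_ `&` _)); apply/seteqP; split => t /AD1.
Qed.

End Rotation.

(** * Integrals of functions that are constant on a set of full measure *)

Section ConullSets.
Local Open Scope ereal_scope.
Context d (T : measurableType d) {R : realType} (P : probability T R).

Import HBNNSimple.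

(* f need not be measurable, the integral being a supremum over simple        *)
(* functions: this allows for a joint spectrum not known to be measurable.    *)
Lemma integral_conull_cst (D : set T) (f : T -> \bar R) (c : \bar R) :
  measurable D -> P D = 1 -> (forall x, 0 <= f x) -> 0 <= c ->
  (forall x, D x -> f x = c) -> \int[P]_x f x = c.
Proof.
move=> mD PD f0 c0 fc.
have icst : \int[P]_(x in D) (fun=> c) x = c by rewrite integral_cst
  // [X in c * X](_ : _ = 1) ?mule1.
apply/eqP; rewrite eq_le; apply/andP; split.
  rewrite ge0_integralTE //; apply: ub_ereal_sup => _ [h /= hf <-].
  rewrite -integralT_nnsfun (ge0_negligible_integral (measurableC mD)) //=.
  - rewrite setTD setCK -[leRHS]icst; apply: ge0_le_integral => //.
    + by move=> x _; rewrite lee_fin.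
    + exact/measurable_EFinP/measurable_funTS.
    + by move=> x Dx; rewrite -(fc _ Dx).
  - exact/measurable_EFinP.
  - by move=> x _; rewrite lee_fin.
  - by have := probability_setC P mD; rewrite PD subee.
rewrite -[leLHS]icst integral_mkcond ge0_integralTE; last first.
  by move=> x; rewrite patchE; case: ifP.
rewrite ge0_integralTE //; apply: ereal_sup_le => _ [h /= hf <-].
exists h => // x; apply: le_trans (hf x) _.
by rewrite patchE; case: ifPn => // /set_mem /fc ->.
Qed.

End ConullSets.

(** * Haar measure of the torus and its uniqueness *)

Section Torus.
Context {R : realType}.
Local Notation C := R[i].
Local Open Scope ereal_scope.

Lemma haar_circle (S : set C) : circle `<=` S -> haar R S = 1.
Proof.
move=> cS; rewrite /haar /distribution /pushforward /=.
rewrite (_ : _ @^-1` S = setT) ?probability_setT //.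
by apply/seteqP; split => // t _; apply: cS; exact: circle_expi2pi.
Qed.

Lemma torusE : @torus R = circle `*` circle.
Proof. by []. Qed.

Lemma measurable_torus : measurable (@torus R).
Proof. by rewrite torusE; apply: measurableX; exact: measurable_circle. Qed.

(** The product measure of any set, measurable or not, is by definition the integral of the measures
    of its sections, and these are 1 over the circle. The generality serves the joint spectrum,
    whose preimage is not shown to be measurable. *)
Lemma haar2_torus (S : set (C * C)) : @torus R `<=` S -> haar2 R S = 1.
Proof.
move=> tS; rewrite /haar2 /= /product_measure1.
apply: (integral_conull_cst measurable_circle) => //; first exact: haar_circle.
move=> x cx /=; apply: haar_circle => y cy; rewrite /xsection /= inE.
exact: tS.
Qed.

Definition cmul2 (z w : C * C) : C * C := (z.1 * w.1, z.2 * w.2)%R.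

Lemma measurable_fst_complex :
  measurable_fun [set: C * C] (fun w : C * C => w.1).
Proof. exact: measurable_fst. Qed.

Lemma measurable_snd_complex :
  measurable_fun [set: C * C] (fun w : C * C => w.2).
Proof. exact: measurable_snd. Qed.

Lemma measurable_cmul2 z : measurable_fun setT (cmul2 z).
Proof.
by apply: measurable_fun_pair; apply: measurable_complexM.
Qed.

Lemma haar2_rotation z (B : set (C * C)) : @torus R z -> measurable B ->
  haar2 R (cmul2 z @^-1` B) = haar2 R B.
Proof.
move=> [z1 z2] mB; have mz := measurable_cmul2 z.
pose f : {mfun (C * C)%type >-> (C * C)%type} :=
  HB.pack (cmul2 z) (@isMeasurableFun.Build _ _ _ _ _ mz).
suff E : (haar R \x haar R) B = pushforward (haar2 R) f B by exact: esym E.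
apply: product_measure_unique => // A A' mA mA'.
rewrite -[RHS]/(haar R A * haar R A') -(haar_rotation z1 mA)
  -(haar_rotation z2 mA').
have mr (y : C) (E : set C) : measurable E -> measurable ( *%R y @^-1` E).
  move=> mE; rewrite -[X in measurable X]setTI.
  have : measurable_fun setT (fun x : C => y * x)%R
    by exact: measurable_complexM.
  by move=> /(_ measurableT _ mE).
by rewrite -product_measure1E; [|exact: mr|exact: mr].
Qed.

(** Fubini on the set of pairs (z, w) with zw in [B]: the sections at fixed z all have [nu]-measure
    [nu B], and those at fixed w all have Haar measure [haar2 R B], for z and w on the torus. *)
Lemma haar2_unique (nu : probability (C * C)%type R) : nu (@torus R) = 1 ->
  (forall z B, @torus R z -> measurable B -> nu (cmul2 z @^-1` B) = nu B) ->
  forall B, measurable B -> nu B = haar2 R B.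
Proof.
move=> nuT nuI B mB.
pose S := [set p : (C * C) * (C * C) | B (cmul2 p.1 p.2)].
have mS : measurable S.
  rewrite -[S]setTI.
  suff : measurable_fun setT (fun p : (C * C) * (C * C) => cmul2 p.1 p.2)
    by exact.
  have m1 : measurable_fun setT (fun p : (C * C) * (C * C) => p.1)
    by exact: measurable_fst.
  have m2 : measurable_fun setT (fun p : (C * C) * (C * C) => p.2)
    by exact: measurable_snd.
  apply: measurable_fun_pair; apply: measurable_complexM.
  - exact: (measurableT_comp measurable_fst_complex m1).
  - exact: (measurableT_comp measurable_fst_complex m2).
  - exact: (measurableT_comp measurable_snd_complex m1).
  - exact: (measurableT_comp measurable_snd_complex m2).
have := indic_fubini_tonelli (haar2 R) nu mS.
rewrite indic_fubini_tonelli_FE // indic_fubini_tonelli_GE //.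
rewrite (integral_conull_cst (c := nu B) measurable_torus); last first.
- move=> z tz /=; rewrite -[RHS](nuI _ _ tz mB); congr (nu _).
  by apply/seteqP; split => w; rewrite /xsection /= inE.
- exact: measure_ge0.
- by move=> z; exact: measure_ge0.
- exact: haar2_torus.
rewrite (integral_conull_cst (c := haar2 R B) measurable_torus); last first.
- move=> z tz /=; rewrite -[RHS](haar2_rotation tz mB); congr (haar2 R _).
  by apply/seteqP; split => w;
    rewrite /ysection /= inE /S /cmul2 /= !(mulrC z.1, mulrC z.2).
- exact: measure_ge0.
- by move=> z; exact: measure_ge0.
- exact: nuT.
exact.
Qed.

End Torus.

(** * The action of GL(2, Z) on the torus *)

Section TorusAction.
Context {R : realType}.
Local Notation C := R[i].
Local Open Scope ereal_scope.

Lemma measurable_act (g : 'M[int]_2) : measurable_fun setT (@act R g).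
Proof.
apply: measurable_fun_pair; apply: measurable_complexM;
  apply: measurable_complex_exprz;
  by [exact: measurable_fst_complex|exact: measurable_snd_complex].
Qed.

Lemma act_torus g w : @torus R w -> torus (act g w).
Proof.
by move=> [w1 w2]; split; apply: circleM; exact: circle_exprz.
Qed.

Lemma act1 (w : C * C) : act 1 w = w.
Proof.
case: w => a b; rewrite /act !mxE /= !expr1z !expr0z.
by rewrite mulr1 mul1r.
Qed.

Lemma exprz_pair_lin (a b : C) (p q r s x y : int) : a != 0%R -> b != 0%R ->
  (a ^ (x * p + y * q) * b ^ (x * r + y * s) =
  (a ^ p * b ^ r) ^ x * (a ^ q * b ^ s) ^ y)%R.
Proof.
move=> a0 b0; rewrite !expfzDr // !expfzMl !exprz_exp mulrACA.
by rewrite (mulrC p) (mulrC r) (mulrC q) (mulrC s).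
Qed.

Lemma actM g h (w : C * C) : @torus R w -> act (g * h) w = act g (act h w).
Proof.
case=> /circle_neq0 w1 /circle_neq0 w2.
rewrite /act !mxE !big_ord_recl !big_ord0 /= !addr0.
rewrite (_ : lift _ _ = 1%R); last exact: val_inj.
by congr pair; exact: exprz_pair_lin.
Qed.

Lemma act_cmul2 g (z w : C * C) : act g (cmul2 z w) = cmul2 (act g z) (act g w).
Proof.
by rewrite /act /cmul2 /= !expfzMl; congr pair; rewrite mulrACA.
Qed.

(** The image of Haar measure under [act g] is again rotation invariant: rotating by z after acting
    by g amounts to rotating by [act g^-1 z] before. Uniqueness then identifies the two measures. *)
Lemma haar2_act g (B : set (C * C)) : g \is a GRing.unit -> measurable B ->
  haar2 R (act g @^-1` B) = haar2 R B.
Proof.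
move=> ug.
pose f : {mfun (C * C)%type >-> (C * C)%type} :=
  HB.pack (@act R g) (@isMeasurableFun.Build _ _ _ _ _ (measurable_act g)).
apply: (haar2_unique (nu := distribution (haar2 R) f)) => /=.
  by apply: haar2_torus => w; exact: act_torus.
move=> z {}B tz mB; rewrite /distribution /pushforward /=.
have mA : measurable (act g @^-1` B).
  by rewrite -[X in measurable X]setTI; apply: measurable_act.
rewrite -[RHS](haar2_rotation (act_torus g^-1 tz) mA).
congr (haar2 R _); apply/seteqP; split => w;
  by rewrite /= act_cmul2 -actM // mulrV // act1.
Qed.

(** The units form a subgroup containing the generators, so the smallest such subgroup lies inside
    them. *)
Lemma Gamma_unit G g : Gamma G g -> g \is a GRing.unit.
Proof.
move=> Gg.
suff /(_ _ Gg) : Gamma G `<=` [set g | g \is a GRing.unit] by [].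
apply: smallest_sub.
  split => //=; first exact: unitr1.
    by move=> a b ua ub; rewrite unitrMl.
  by move=> a ua; rewrite unitrV.
have det_unit (a b c e : int) : (a * e - b * c)%R \is a GRing.unit ->
  mx2 a b c e \is a GRing.unit.
  move=> h; rewrite -[_ \is a _]/(_ \in unitmx) unitmxE (expand_det_row _ 0%R).
  rewrite !big_ord_recl big_ord0 /cofactor !det_mx11 !mxE /= expr0 expr1 addr0
    mul1r mulN1r mulrN.
  exact: h.
by case: G {Gg} => /=; rewrite ?subUset; (repeat split) => _ /= ->;
  rewrite ?unitrN ?unitr1 //; exact: det_unit.
Qed.

End TorusAction.

(** * Characters of the torus and trigonometric polynomials *)

Section TorusCharacters.
Context {R : realType}.
Local Notation C := R[i].
Implicit Types (w z : C * C) (k l : weight).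

Definition sig k w : C := w.1 ^ k 0 0 * w.2 ^ k 0 1.

Lemma sig0 w : sig 0 w = 1.
Proof. by rewrite /sig !mxE !expr0z mulr1. Qed.

Lemma sigD k l w : torus w -> sig (k + l) w = sig k w * sig l w.
Proof.
case=> /circle_neq0 w1 /circle_neq0 w2.
by rewrite /sig !mxE !expfzDr // mulrACA.
Qed.

Lemma sig_circle k w : torus w -> circle (sig k w).
Proof. by case=> w1 w2; apply: circleM; exact: circle_exprz. Qed.

Lemma sigN k w : torus w -> sig (- k) w = conjc (sig k w).
Proof.
move=> tw; rewrite (circle_conj (sig_circle k tw)).
have k0 := circle_neq0 (sig_circle k tw).
by apply: (mulfI k0); rewrite -sigD // subrr sig0 divff.
Qed.

Lemma sig_cmul2 k z w : sig k (cmul2 z w) = sig k z * sig k w.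
Proof. by rewrite /sig /cmul2 /= !expfzMl mulrACA. Qed.

Lemma measurable_sig k : measurable_fun setT (sig k).
Proof. by apply: measurable_complexM; exact: measurable_complex_exprz. Qed.

Lemma wtE k : k = wt (k 0 0) (k 0 1).
Proof.
apply/rowP => j; rewrite mxE.
by have [->|->] : j = 0 \/ j = 1
  by case: j => -[|[|//]] ?; [left|right]; apply: val_inj.
Qed.

Lemma weight_eq0 k : k 0 0 = 0 -> k 0 1 = 0 -> k = 0.
Proof.
move=> k0 k1; rewrite [k]wtE k0 k1; apply/rowP => j.
by rewrite !mxE; case: ifP.
Qed.

Lemma expi2pi_exprz (t : R) (n : int) : expi2pi t ^ n = expi2pi (n%:~R * t).
Proof.
have eX (m : nat) : expi2pi t ^+ m = expi2pi (m%:R * t).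
  elim: m => [|m IH]; last by rewrite exprS IH -expi2piD -add1n natrD mulrDl
    mul1r.
  rewrite expr0 mul0r /expi2pi mulr0 cos0 sin0.
  by apply/eqP; rewrite eq_complex /= !eqxx.
case: n => m; first by rewrite -exprnP eX.
rewrite NegzE -exprnN eX mulrNz -pmulrn.
apply: (mulfI (circle_neq0 (circle_expi2pi (m.+1%:R * t)))).
rewrite divff ?(circle_neq0 (circle_expi2pi _)) // -expi2piD mulNr subrr.
rewrite /expi2pi mulr0 cos0 sin0.
by apply/eqP; rewrite eq_complex /= !eqxx.
Qed.

(** A rotation by such a z reverses the sign of the character, which forces its integral to
    vanish. *)
Lemma sig_neg1 k : k != 0 -> exists2 z, torus z & sig k z = - 1.
Proof.
move=> k0; have [k00|k00] := eqVneq (k 0 0) 0.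
  have k1 : k 0 1 != 0 by apply: contraNneq k0 => k1; apply/eqP/weight_eq0.
  exists (1, expi2pi (2^-1 / (k 0 1)%:~R)).
    by split => /=; [exact: circle1|exact: circle_expi2pi].
  by rewrite /sig /= exp1rz mul1r expi2pi_exprz mulrC divfK ?intr_eq0
    // expi2pi_half.
exists (expi2pi (2^-1 / (k 0 0)%:~R), 1).
  by split => /=; [exact: circle_expi2pi|exact: circle1].
by rewrite /sig /= exp1rz mulr1 expi2pi_exprz mulrC divfK ?intr_eq0
  // expi2pi_half.
Qed.

Definition trig_sum (s : seq (C * weight)) w : C :=
  \sum_(p <- s) p.1 * sig p.2 w.

Lemma measurable_trig_sum s : measurable_fun setT (trig_sum s).
Proof.
rewrite /trig_sum; elim: s => [|p s IH].
  by under eq_fun do rewrite big_nil; exact: measurable_cst.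
under eq_fun do rewrite big_cons; apply: measurable_complexD => //.
by apply: measurable_complexM => //; exact: measurable_sig.
Qed.

Lemma normc_trig_sum s w : torus w ->
  normc (trig_sum s w) <= \sum_(p <- s) normc p.1.
Proof.
move=> tw; rewrite /trig_sum; elim: s => [|p s IH].
  by rewrite !big_nil /= expr0n /= addr0 sqrtr0.
rewrite !big_cons; apply: le_trans (le_normcD _ _) _.
by rewrite normcM (sig_circle _ tw) mulr1 lerD2l.
Qed.

Lemma normr_Re_le (z : C) : `|complex.Re z| <= normc z.
Proof.
case: z => a b /=; rewrite -sqrtr_sqr ler_sqrt ?lerDl ?sqr_ge0 //.
by rewrite addr_ge0 // sqr_ge0.
Qed.

Lemma normr_Im_le (z : C) : `|complex.Im z| <= normc z.
Proof.
case: z => a b /=; rewrite -sqrtr_sqr ler_sqrt ?lerDr ?sqr_ge0 //.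
by rewrite addr_ge0 // sqr_ge0.
Qed.

End TorusCharacters.

(** * Change of variables *)

Section ImageMeasure.
Local Open Scope ereal_scope.

Lemma Rintegral_image d d' (T : measurableType d) (T' : measurableType d')
    (R : realType) (m : {measure set T -> \bar R})
    (m' : {measure set T' -> \bar R}) (h : T -> T') (u : T' -> R) :
  measurable_fun setT h -> measurable_fun setT u ->
  (forall B, measurable B -> m' B = m (h @^-1` B)) ->
  m.-integrable setT (EFin \o (fun x => u (h x))) ->
  Rintegral m' setT u = Rintegral m setT (fun x => u (h x)).
Proof.
move=> mh mu mm' iu; congr fine.
pose r : {mfun T >-> T'} := HB.pack h (@isMeasurableFun.Build _ _ _ _ _ mh).
transitivity (\int[pushforward m r]_(y in setT) (EFin \o u) y).
  by apply: eq_measure_integral => B mB _; exact: mm'.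
by rewrite integral_pushforward //; exact/measurable_EFinP.
Qed.

End ImageMeasure.

(** * Integration on the torus and orthogonality of characters *)

Section TorusIntegral.
Context {R : realType}.
Local Notation C := R[i].
Local Notation P := (haar2 R).
Implicit Types (f g : C * C -> C) (u : C * C -> R).

Lemma haar2_torusC : P (~` @torus R) = 0%E.
Proof.
rewrite (probability_setC P measurable_torus) (haar2_torus (S := @torus R)) //.
by rewrite subee.
Qed.

Lemma torus_integrable u (M : R) : measurable_fun setT u ->
  (forall w, torus w -> `|u w| <= M) -> P.-integrable setT (EFin \o u).
Proof.
move=> mu uM.
have mT := @measurable_torus R.
have PNT : P (~` @torus R) = 0%E := haar2_torusC.
apply/(negligible_integrable (N := ~` @torus R) (measurableC mT) measurableT)
  => //.
  exact/measurable_EFinP.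
rewrite setTD setCK; apply: measurable_bounded_integrable => //.
- by rewrite [X in (X < _)%E](haar2_torus (S := @torus R)) ?ltry.
- exact: measurable_funTS.
- exists M; split; first exact: num_real.
  by move=> x Mx w tw /=; apply: le_trans (uM _ tw) (ltW Mx).
Qed.

Lemma eq_Rintegral_torus u v : measurable_fun setT u -> measurable_fun setT v ->
  (forall w, torus w -> u w = v w) -> Rintegral P setT u = Rintegral P setT v.
Proof.
move=> mu mv uv; have mT := @measurable_torus R.
congr fine; apply: ae_eq_integral => //; try exact/measurable_EFinP.
exists (~` @torus R); split; first exact: measurableC.
  exact: haar2_torusC.
by move=> w /= uvw tw; apply: uvw => _; rewrite uv.
Qed.

(** The formula is demanded on the torus alone, since rules such as [sigD] and [sigN] are available
    only there; measurability is demanded everywhere because integrals run over all of C * C. *)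
Definition trig f : Prop := measurable_fun setT f /\
  exists s, forall w, torus w -> f w = trig_sum s w.

Lemma trig_integrable f : trig f ->
  P.-integrable setT (EFin \o (fun w => complex.Re (f w))) /\
  P.-integrable setT (EFin \o (fun w => complex.Im (f w))).
Proof.
move=> [mf [s fs]].
split; apply: (torus_integrable (M := \sum_(p <- s) normc p.1)).
- exact: measurable_ReT.
- move=> w tw; rewrite fs //; apply: le_trans (normr_Re_le _) _.
  exact: normc_trig_sum.
- exact: measurable_ImT.
- move=> w tw; rewrite fs //; apply: le_trans (normr_Im_le _) _.
  exact: normc_trig_sum.
Qed.

Lemma trig_trig_sum s : trig (trig_sum s).
Proof. by split; [exact: measurable_trig_sum|exists s]. Qed.

Lemma eq_cintegral_torus f g : measurable_fun setT f -> measurable_fun setT g ->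
  (forall w, torus w -> f w = g w) -> cintegral P f = cintegral P g.
Proof.
move=> mf mg fg; rewrite /cintegral; congr (_ +i* _).
  apply: eq_Rintegral_torus; [exact: measurable_ReT|exact: measurable_ReT|].
  by move=> w /fg ->.
apply: eq_Rintegral_torus; [exact: measurable_ImT|exact: measurable_ImT|].
by move=> w /fg ->.
Qed.

Lemma cintegralD f g : trig f -> trig g ->
  cintegral P (fun w => f w + g w) = cintegral P f + cintegral P g.
Proof.
move=> /trig_integrable[fr fi] /trig_integrable[gr gi].
rewrite /cintegral [RHS]/GRing.add /= -!RintegralD //.
congr (_ +i* _); apply: eq_Rintegral => w _; by case: (f w) (g w) => [? ?] [].
Qed.

Lemma cintegral_cst (c : C) : cintegral P (fun=> c) = c.
Proof.
have PT : fine (P setT) = 1 by rewrite probability_setT.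
by rewrite /cintegral !Rintegral_cst // [fine _]PT !mulr1; case: c.
Qed.

Lemma cintegral_image (nu : probability (C * C)%type R) (h : C * C -> C * C) f :
  measurable_fun setT h -> measurable_fun setT f ->
  (forall B, measurable B -> nu B = P (h @^-1` B)) ->
  trig (fun w => f (h w)) -> cintegral nu f = cintegral P (fun w => f (h w)).
Proof.
move=> mh mf nuP /trig_integrable[fr fi].
by rewrite /cintegral (Rintegral_image mh (measurable_ReT mf) nuP fr)
  (Rintegral_image mh (measurable_ImT mf) nuP fi).
Qed.

Lemma cintegral_rotation f z : trig f -> torus z ->
  cintegral P (fun w => f (cmul2 z w)) = cintegral P f.
Proof.
move=> tf tz.
have mz := measurable_cmul2 z.
have tfz : trig (fun w => f (cmul2 z w)).
  case: tf => mf [s fs]; split; first exact: measurableT_comp mz.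
  exists [seq (p.1 * sig p.2 z, p.2) | p <- s] => w tw.
  rewrite fs /trig_sum ?big_map; last by case: tz tw => [? ?] []; split;
    exact: circleM.
  by apply: eq_bigr => p _; rewrite sig_cmul2 mulrA.
have PI B : measurable B -> P B = P (cmul2 z @^-1` B).
  by move=> mB; exact: esym (haar2_rotation tz mB).
by rewrite (cintegral_image mz tf.1 PI tfz).
Qed.

Lemma cintegral_trig_sum s :
  cintegral P (trig_sum s) = \sum_(p <- s) p.1 * (p.2 == 0)%:R.
Proof.
elim: s => [|[c k] s IH].
  by rewrite /trig_sum big_nil; under eq_fun do rewrite big_nil;
    exact: cintegral_cst.
rewrite big_cons -IH /=.
have -> : trig_sum ((c, k) :: s) =
  (fun w => trig_sum [:: (c, k)] w + trig_sum s w).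
  by apply/funext => w; rewrite /trig_sum !big_cons big_nil addr0.
rewrite cintegralD; [|exact: trig_trig_sum|exact: trig_trig_sum].
congr (_ + _); have mck := measurable_trig_sum [:: (c, k)].
have [->|k0] := eqVneq k 0.
  rewrite mulr1 -[RHS]cintegral_cst; congr cintegral.
  by apply/funext => w; rewrite /trig_sum big_seq1 /= sig0 mulr1.
have [z tz kz] := @sig_neg1 R k k0.
rewrite mulr0; set I := cintegral _ _.
(* One of the two copies of [I] is rotated by z, which turns the coefficient c into -c, so that the
   integrands cancel. *)
suff : I + I = 0 by move/eqP; rewrite -mulr2n mulrn_eq0 /= => /eqP.
rewrite {2}/I -(cintegral_rotation (z := z)) //; last exact: trig_trig_sum.
have -> : (fun w => trig_sum [:: (c, k)] (cmul2 z w)) = trig_sum [:: (- c, k)].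
  by apply/funext => w;
    rewrite /trig_sum !big_seq1 /= sig_cmul2 kz mulN1r mulrN mulNr.
rewrite /I -cintegralD; [|exact: trig_trig_sum|exact: trig_trig_sum].
rewrite -[RHS]cintegral_cst; congr cintegral; apply/funext => w.
by rewrite /trig_sum !big_seq1 /= mulNr subrr.
Qed.

End TorusIntegral.

(** * Infinite sums of finitely supported families *)

Section FinitelySupportedSums.
Context {R : realType}.

Lemma esum_seq (T : choiceType) (g : T -> \bar R) (s : seq T) : uniq s ->
  (forall t, 0 <= g t)%E -> (forall t, t \notin s -> g t = 0%E) ->
  (\esum_(t in setT) g t = \sum_(t <- s) g t)%E.
Proof.
move=> us g0 gs; rewrite fsbig_seq // -esum_fset //.
rewrite [RHS]esum_mkcond; apply: eq_esum => t _.
by case: ifPn => //; rewrite notin_setE => /negP/gs.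
Qed.

Lemma rsum_seq (f : weight -> R) (s : seq weight) : uniq s ->
  (forall nu, nu \notin s -> f nu = 0) -> rsum f = \sum_(k <- s) f k.
Proof.
move=> us f0; rewrite /rsum !(esum_seq us) //; first last.
- by move=> nu /f0 nuk; rewrite funeposE /= nuk maxxx.
- by move=> nu /f0 nuk; rewrite funenegE /= nuk oppr0 maxxx.
under eq_bigr do rewrite funeposE /= -EFin_max.
under [X in _ - fine X]eq_bigr do rewrite funenegE /= -EFin_max.
rewrite !sumEFin /= -sumrB; apply: eq_bigr => k _.
by rewrite /Order.max; case: ltP => ?; case: ltP => ?; lra.
Qed.

End FinitelySupportedSums.

(** * Fourier correspondence and the cross moments *)

Section Moments.
Context {R : realType}.
Local Notation C := R[i].
Local Notation P := (haar2 R).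
Implicit Types (x : l2 R) (f : C * C -> C) (p : laurent).

Lemma measurable_leval p : measurable_fun setT (@leval R p).
Proof.
rewrite /leval; elim: (finsupp p : seq weight) => [|k s IH].
  by under eq_fun do rewrite big_nil; exact: measurable_cst.
under eq_fun do rewrite big_cons; apply: measurable_complexD => //.
by apply: measurable_complexM => //; exact: measurable_sig.
Qed.

(** The vector [x] is the family of Fourier coefficients of [f] on the torus. The list [s] holds
    pairs of a coefficient and a frequency; frequencies may repeat, so that products need no
    collecting of terms. *)
Definition symbol x f : Prop := exists s : seq (C * weight),
  (forall nu, x nu = \sum_(q <- s) q.1 * (nu == q.2)%:R) /\
  (forall w, torus w -> f w = trig_sum s w).

Lemma vacuumE nu : @vacuum R nu = (nu == 0)%:R.
Proof.
rewrite /= /Omega -natrM mulnb; congr (nat_of_bool _)%:R.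
apply/andP/eqP => [[/eqP h0 /eqP h1]|->]; first exact: weight_eq0.
by rewrite !mxE.
Qed.

Lemma symbol_vacuum : symbol (@vacuum R) (fun=> 1).
Proof.
exists [:: (1, 0)]; split => [nu|w tw];
  last by rewrite /trig_sum big_seq1 sig0 mulr1.
by rewrite big_seq1 /= mul1r -vacuumE.
Qed.

(** Translating Fourier coefficients by k multiplies the function by the character [sig k]. *)
Lemma symbol_shift_sum (t : seq weight) (c : weight -> C)
  (h : weight -> weight) x f :
  symbol x f ->
  symbol (\sum_(k <- t) c k *: Defs.shift (h k) x)
    (fun w => (\sum_(k <- t) c k * sig (h k) w) * f w).
Proof.
move=> [s [xs fs]].
exists [seq (c k * q.1, h k + q.2) | k <- t, q <- s]; split => [nu|w tw].
  rewrite l2_sumE big_allpairs_dep /=; apply: eq_bigr => k _ /=.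
  rewrite -[LHS]/(c k * x (nu - h k)) xs mulr_sumr; apply: eq_bigr => q _.
  by rewrite mulrA subr_eq addrC.
rewrite fs // /trig_sum big_allpairs_dep mulr_suml; apply: eq_bigr => k _ /=.
rewrite mulr_sumr; apply: eq_bigr => q _ /=.
by rewrite sigD // mulrACA.
Qed.

Lemma symbol_adjacency G l x f : symbol x f ->
  symbol (adjacency (edges R G l) x) (fun w => leval (chi R G l) w * f w).
Proof.
rewrite adjacencyE => xf.
exact: (symbol_shift_sum _ (fun k => (chi R G l k)%:R) id xf).
Qed.

Lemma conjc_leval p (w : C * C) : torus w ->
  conjc (leval p w) = \sum_(k <- finsupp p) (p k)%:R * sig (- k) w.
Proof.
move=> tw; rewrite /leval rmorph_sum; apply: eq_bigr => k _.
by rewrite sigN // rmorphM /= conjc_nat.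
Qed.

Lemma eq_symbol x f g : (forall w, torus w -> f w = g w) -> symbol x f ->
  symbol x g.
Proof.
by move=> fg [s [xs fs]]; exists s; split => // w tw; rewrite -fg // fs.
Qed.

Lemma symbol_adjacency_tr G l x f : symbol x f ->
  symbol (adjacency (transpose (edges R G l)) x)
    (fun w => conjc (leval (chi R G l) w) * f w).
Proof.
rewrite adjacency_trE.
move=> /(symbol_shift_sum (finsupp (chi R G l)) (fun k => (chi R G l k)%:R)
  -%R).
by apply: eq_symbol => w tw; rewrite conjc_leval.
Qed.

Lemma symbol_iter (A : l2 R -> l2 R) (g : C * C -> C) n x f :
  (forall y f', symbol y f' -> symbol (A y) (fun w => g w * f' w)) ->
  symbol x f -> symbol (iter n A x) (fun w => g w ^+ n * f w).
Proof.
move=> Ag xf; elim: n => [|n IH].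
  by apply: eq_symbol xf => w _; rewrite mul1r.
by apply: eq_symbol (Ag _ _ IH) => w _; rewrite exprS mulrA.
Qed.

Lemma csum_seq (f : weight -> C) (s : seq weight) : uniq s ->
  (forall nu, nu \notin s -> f nu = 0) -> csum f = \sum_(k <- s) f k.
Proof.
move=> us f0; rewrite /csum !(rsum_seq us); last 2 first.
- by move=> nu /f0 ->.
- by move=> nu /f0 ->.
elim: s {us f0} => [|k s IH]; first by rewrite !big_nil.
by rewrite !big_cons -IH; case: (f k).
Qed.

Lemma csum_supp1 (f : weight -> C) k : (forall nu, nu != k -> f nu = 0) ->
  csum f = f k.
Proof.
move=> f0; rewrite (@csum_seq _ [:: k]) ?big_seq1 // => nu.
by rewrite inE; exact: f0.
Qed.

Lemma phiE (T : l2 R -> l2 R) : phi T = T (@vacuum R) 0.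
Proof.
rewrite /phi /inner (@csum_supp1 _ 0) => [|nu nu0].
  by rewrite vacuumE eqxx conjc1 mulr1.
by rewrite vacuumE (negbTE nu0) conjc0 mulr0.
Qed.

(** Both sides add up the coefficients of frequency 0 in the list witnessing [symbol]. *)
Lemma symbol_cintegral x f : measurable_fun setT f -> symbol x f ->
  x 0 = cintegral P f.
Proof.
move=> mf [s [xs fs]];
  rewrite (eq_cintegral_torus mf (measurable_trig_sum s) fs).
by rewrite cintegral_trig_sum xs; apply: eq_bigr => q _; rewrite eq_sym.
Qed.

Lemma measurable_monomial m1 n1 m2 n2 :
  measurable_fun setT (@monomial R m1 n1 m2 n2).
Proof.
do 3 (apply: measurable_complexM; last by apply: measurable_complexX;
  do ?apply: measurable_conjc).
exact: measurable_complexX.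
Qed.

Lemma measurable_chi_pair G : measurable_fun setT (@chi_pair R G).
Proof. by apply: measurable_fun_pair; exact: measurable_leval. Qed.

Definition chi_moment G m1 n1 m2 n2 (w : C * C) : C :=
  monomial m1 n1 m2 n2 (chi_pair G w).

Lemma measurable_chi_moment G m1 n1 m2 n2 :
  measurable_fun setT (chi_moment G m1 n1 m2 n2).
Proof.
exact: (measurableT_comp (measurable_monomial _ _ _ _) (measurable_chi_pair G)).
Qed.

Lemma chi_moment_symbol G m1 n1 m2 n2 :
  symbol ((iter m1 (adjacency (edges R G (rho1 G))) \o
           iter n1 (adjacency (transpose (edges R G (rho1 G)))) \o
           iter m2 (adjacency (edges R G (rho2 G))) \o
           iter n2 (adjacency (transpose (edges R G (rho2 G))))) (@vacuum R))
    (chi_moment G m1 n1 m2 n2).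
Proof.
have A l := fun x f => @symbol_adjacency G l x f.
have At l := fun x f => @symbol_adjacency_tr G l x f.
apply: eq_symbol (symbol_iter m1 (A _) (symbol_iter n1 (At _)
  (symbol_iter m2 (A _) (symbol_iter n2 (At _) symbol_vacuum)))) => w _.
by rewrite /chi_moment /monomial mulr1 !mulrA.
Qed.

Lemma cross_momentE G m1 n1 m2 n2 :
  cross_moment R (edges R G (rho1 G)) (edges R G (rho2 G)) m1 n1 m2 n2 =
  cintegral P (chi_moment G m1 n1 m2 n2).
Proof.
rewrite /cross_moment phiE.
exact: symbol_cintegral (measurable_chi_moment _ _ _ _ _)
  (chi_moment_symbol _ _ _ _ _).
Qed.

End Moments.

(** * The norm of square-summable vectors *)

Section L2Norm.
Context {R : realType}.
Local Notation C := R[i].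
Implicit Types (x y : l2 R) (c : C).

Lemma l2P x y : (forall nu, x nu = y nu) -> x = y.
Proof. by move=> xy; apply: val_inj; apply/funext. Qed.

Lemma l2Z_apply c x nu : (c *: x) nu = c * x nu.
Proof. by []. Qed.

Definition l2normsq x : R := fine (\esum_(mu in setT) (normc (x mu) ^+ 2)%:E)%E.

Lemma l2normsqE x :
  ((l2normsq x)%:E = \esum_(mu in setT) (normc (x mu) ^+ 2)%:E)%E.
Proof.
rewrite fineK // ge0_fin_numE; first exact: asboolW (l2_funP x).
by apply: esum_ge0 => mu _; rewrite lee_fin sqr_ge0.
Qed.

Lemma l2normsq_ge0 x : 0 <= l2normsq x.
Proof. by rewrite -lee_fin l2normsqE; apply: esum_ge0 => mu _;
  rewrite lee_fin sqr_ge0. Qed.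

Lemma l2norm_ge0 x : 0 <= l2norm x.
Proof. exact: sqrtr_ge0. Qed.

Lemma sqr_l2norm x : l2norm x ^+ 2 = l2normsq x.
Proof. by rewrite sqr_sqrtr // l2normsq_ge0. Qed.

Lemma l2normsqD x y : l2normsq (x + y) <= 2 * (l2normsq x + l2normsq y).
Proof.
have sq0 (z : l2 R) mu : (0 <= (normc (z mu) ^+ 2)%:E :> \bar R)%E
  by rewrite lee_fin sqr_ge0.
rewrite mulrDr !mulr_natl -lee_fin !mulr2n !EFinD !l2normsqE.
rewrite -!esumD; try by move=> *; rewrite ?adde_ge0.
apply: le_esum => mu _; rewrite -!EFinD lee_fin.
by apply: le_trans (normcD_sq _ _) _; rewrite !mulr_natl !mulr2n.
Qed.

(* The factor 2 spares a proof of Minkowski's inequality. *)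
Lemma l2norm_quasi_triangle x y : l2norm (x + y) <= 2 * (l2norm x + l2norm y).
Proof.
rewrite -(ler_pXn2r (n := 2)) ?nnegrE ?l2norm_ge0 //; last first.
  by rewrite mulr_ge0 // addr_ge0 ?l2norm_ge0.
rewrite sqr_l2norm; apply: le_trans (l2normsqD _ _) _.
rewrite -!sqr_l2norm.
have := l2norm_ge0 x; have := l2norm_ge0 y; nra.
Qed.

Lemma normc_ge0 c : 0 <= normc c.
Proof. by case: c => a b; exact: sqrtr_ge0. Qed.

Lemma l2normZ_le c x : l2norm (c *: x) <= normc c * l2norm x.
Proof.
rewrite -(ler_pXn2r (n := 2)) ?nnegrE ?l2norm_ge0 //; last first.
  by rewrite mulr_ge0 ?l2norm_ge0 ?normc_ge0.
rewrite exprMn !sqr_l2norm -lee_fin EFinM !l2normsqE.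
apply: ub_ereal_sup => _ [X [finX _] <-].
under eq_fsbigr do rewrite l2Z_apply normcM exprMn EFinM.
rewrite -ge0_mule_fsumr; last by move=> mu; rewrite lee_fin sqr_ge0.
apply: lee_wpmul2l; first by rewrite lee_fin sqr_ge0.
by apply: ereal_sup_ubound; exists X.
Qed.

(** For nonzero c the converse inequality is [l2normZ_le] applied to the inverse of c. *)
Lemma l2normZ c x : l2norm (c *: x) = normc c * l2norm x.
Proof.
apply/eqP; rewrite eq_le l2normZ_le /=.
have [->|c0] := eqVneq c 0.
  by rewrite /= expr0n /= addr0 sqrtr0 mul0r l2norm_ge0.
have nc : 0 < normc c.
  by rewrite lt0r normc_ge0 andbT; apply: contra_neq c0; exact: eq0_normc.
rewrite -ler_pdivlMl // -[x in l2norm x <= _](scalerK c0).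
by apply: le_trans (l2normZ_le _ _) _; rewrite normcV.
Qed.

Lemma l2normN x : l2norm (- x) = l2norm x.
Proof. by rewrite -scaleN1r l2normZ normcN normc1 mul1r. Qed.

Lemma l2norm_shift k x : l2norm (Defs.shift k x) = l2norm x.
Proof.
congr (Num.sqrt (fine _)); rewrite /=.
rewrite [RHS](@reindex_esum _ _ _ setT setT (fun nu : weight => nu - k)) //.
split => // [mu nu _ _ /addIr //|mu _ /=].
by exists (mu + k) => //; rewrite addrK.
Qed.

Lemma l2shift_is_linear k : linear (@Defs.shift R k).
Proof. by move=> a x y; apply: l2P. Qed.

Lemma l2shiftD k l x : Defs.shift (k + l) x = Defs.shift k (Defs.shift l x).
Proof. by apply: l2P => nu; rewrite /= opprD addrA. Qed.

Lemma l2shift0 x : Defs.shift 0 x = x.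
Proof. by apply: l2P => nu; rewrite /= subr0. Qed.

End L2Norm.

(** * Plane waves cut off to boxes *)

Section BoxVectors.
Context {R : realType} (w : R[i] * R[i]) (tw : torus w).
Local Notation C := R[i].

(** The part at the vertex k of a plane wave. The conjugate makes the shift by k act on the full
    plane wave as [sig k w] rather than its inverse. *)
Definition wave (k : weight) : l2 R :=
  conjc (sig k w) *: Defs.shift k (@vacuum R).

Lemma waveE k nu : wave k nu = conjc (sig nu w) * (nu == k)%:R.
Proof.
rewrite l2Z_apply -[Defs.shift k _ nu]/(@vacuum R (nu - k)) vacuumE subr_eq0.
by case: eqVneq => [->|]; rewrite ?mulr0.
Qed.

Lemma shift_wave k l : Defs.shift k (wave l) = sig k w *: wave (k + l).
Proof.
apply: l2P => nu; rewrite l2Z_apply -[LHS]/(wave l (nu - k)) !waveE.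
rewrite subr_eq (addrC l) mulrA; congr (_ * _).
rewrite -[nu in RHS](subrK k) [in RHS]sigD //.
rewrite (rmorphM (@conjc R) (sig (nu - k) w)) [RHS]mulrCA.
rewrite [X in sig k w * X](circle_conj (sig_circle k tw)) divff ?mulr1 //.
by apply: circle_neq0; exact: sig_circle.
Qed.

Lemma l2norm_waves (s : seq weight) : uniq s ->
  l2norm (\sum_(k <- s) wave k) ^+ 2 = (size s)%:R.
Proof.
move=> us; rewrite sqr_l2norm; apply: EFin_inj; rewrite l2normsqE.
have vE nu : (\sum_(k <- s) wave k) nu = conjc (sig nu w) * (nu \in s)%:R.
  rewrite l2_sumE; under eq_bigr do rewrite waveE.
  rewrite -mulr_sumr; congr (_ * _).
  elim: s us => [|k s IH] /=; first by rewrite big_nil.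
  case/andP => ks us; rewrite big_cons IH // inE.
  by case: eqVneq => [->|_]; rewrite ?(negbTE ks) ?addr0 ?add0r.
have nE nu : nu \in s -> normc ((\sum_(k <- s) wave k) nu) ^+ 2 = 1.
  move=> nus; rewrite vE nus mulr1 (circle_conj (sig_circle nu tw)).
  by rewrite (circleV (sig_circle nu tw)) expr1n.
rewrite (esum_seq us) => [|nu|nu nus]; first last.
- by rewrite vE (negbTE nus) mulr0 /= expr0n /= addr0 sqrtr0 expr0n.
- by rewrite lee_fin sqr_ge0.
rewrite sumEFin big_seq (eq_bigr (fun=> 1)) //.
by rewrite -big_seq big_const_seq count_predT iter_addr_0.
Qed.

Definition box_vector n : l2 R := \sum_(i < n) \sum_(j < n) wave (wt i%:Z j%:Z).

Lemma wt_inj (a b c d : int) : wt a b = wt c d -> (a, b) = (c, d).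
Proof.
by move=> /rowP ab; have := ab 0; have := ab 1; rewrite !mxE /= => -> ->.
Qed.

Lemma l2norm_row n (h : 'I_n -> weight) : injective h ->
  l2norm (\sum_j wave (h j)) ^+ 2 = n%:R.
Proof.
move=> hi; rewrite -(big_map h xpredT wave) l2norm_waves.
  by rewrite size_map /index_enum -enumT size_enum_ord.
by rewrite map_inj_uniq // /index_enum -enumT enum_uniq.
Qed.

Lemma l2norm_box n : l2norm (box_vector n) = n%:R.
Proof.
apply/eqP; rewrite -(eqrXn2 (n := 2)) ?l2norm_ge0 //.
rewrite /box_vector pair_bigA /=.
rewrite -(big_map (fun p : 'I_n * 'I_n => wt p.1%:Z p.2%:Z) xpredT wave)
  l2norm_waves.
  by rewrite size_map /index_enum -enumT -cardT card_prod card_ord natrM expr2.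
rewrite map_inj_uniq /index_enum -?enumT ?enum_uniq //.
by move=> [a b] [c d] /= /wt_inj [/val_inj -> /val_inj ->].
Qed.

Lemma l2shift_sum (I : Type) (s : seq I) (F : I -> l2 R) k :
  Defs.shift k (\sum_(i <- s) F i) = \sum_(i <- s) Defs.shift k (F i).
Proof. by elim/big_rec2: _ => [|i y1 y2 _ <-]; exact: l2P. Qed.

Lemma wtD (a b c d : int) : wt a b + wt c d = wt (a + c) (b + d).
Proof. by apply/rowP => j; rewrite !mxE; case: ifP. Qed.

(** The box is sliced along the direction of the shift, which sends each slice to the next one up to
    the phase [sig k w]; only the two extreme slices, of norm sqrt n each, survive in the
    difference. Rows and columns are two instances. The constant is 16 n = (2 (sqrt n + sqrt n))^2,
    from [l2norm_quasi_triangle]. *)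
Lemma box_vector_shift (h : nat -> l2 R) n k :
  box_vector n = \sum_(i < n) h i ->
  (forall i, Defs.shift k (h i) = sig k w *: h i.+1) ->
  (forall i, l2norm (h i) ^+ 2 = n%:R) ->
  l2norm (Defs.shift k (box_vector n) - sig k w *: box_vector n) ^+ 2 <=
    16 * n%:R.
Proof.
move=> -> hS hn.
have -> : Defs.shift k (\sum_(i < n) h i) = sig k w *: \sum_(i < n) h i.+1.
  by rewrite l2shift_sum scaler_sumr; apply: eq_bigr => i _; exact: hS.
rewrite -scalerBr -sumrB.
rewrite -(big_mkord xpredT (fun i => h i.+1 - h i)) telescope_sumr //.
rewrite l2normZ (sig_circle k tw) mul1r.
have h0n := hn 0%N; have hnn := hn n.
have: l2norm (h n - h 0%N) ^+ 2 <= (2 * (l2norm (h n) + l2norm (h 0%N))) ^+ 2.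
  rewrite ler_pXn2r ?nnegrE ?mulr_ge0 ?addr_ge0 ?l2norm_ge0 //.
  by have := l2norm_quasi_triangle (h n) (- h 0%N); rewrite l2normN.
have := sqr_ge0 (l2norm (h n) - l2norm (h 0%N)); nra.
Qed.

Lemma box_vector_shift1 n :
  l2norm (Defs.shift (wt 1 0) (box_vector n) - sig (wt 1 0) w *: box_vector n)
    ^+ 2
    <= 16 * n%:R.
Proof.
apply: (box_vector_shift
  (h := fun i : nat => \sum_(j < n) wave (wt i%:Z j%:Z))) => // i.
  rewrite l2shift_sum scaler_sumr; apply: eq_bigr => j _; rewrite shift_wave.
  by rewrite wtD add0r addrC -PoszD addn1.
by apply: l2norm_row => j j' /wt_inj [/val_inj].
Qed.

Lemma box_vector_shift2 n :
  l2norm (Defs.shift (wt 0 1) (box_vector n) - sig (wt 0 1) w *: box_vector n)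
    ^+ 2
    <= 16 * n%:R.
Proof.
apply: (box_vector_shift
  (h := fun j : nat => \sum_(i < n) wave (wt i%:Z j%:Z))) => [|j|j].
- exact: exchange_big.
- rewrite l2shift_sum scaler_sumr; apply: eq_bigr => i _; rewrite shift_wave.
  by rewrite wtD add0r addrC -PoszD addn1.
by apply: l2norm_row => i i' /wt_inj [/val_inj].
Qed.

End BoxVectors.

Lemma subr_tele (V : zmodType) (s t p q : V) :
  (s - t) + ((t - q) - (s - p)) = p - q.
Proof. by rewrite opprB addrA subrKA addrC subrKA. Qed.

(** * Limits of families of complex approximations *)

Section ComplexLimit.
Context {R : realType}.
Local Notation C := R[i].
(** [Q e c] is to be read as: c approximates the sought number with precision of order e. *)
Variable Q : R -> C -> Prop.
Hypothesis Q_ex : forall e, 0 < e -> exists c, Q e c.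

(** Every lower bound [h c - 16 * e] lies below every upper bound [h c' + 16 * e'], so the supremum
    of the lower bounds separates them. *)
Lemma real_limit (h : C -> R) :
  (forall e e' c c', 0 < e -> 0 < e' -> Q e c -> Q e' c' ->
    h c - h c' <= 16 * (e + e')) ->
  exists r, forall e c, 0 < e -> Q e c -> `|h c - r| <= 16 * e.
Proof.
move=> hQ; pose L := [set r | exists e c, [/\ 0 < e, Q e c & r = h c - 16 * e]].
have ubL e c : 0 < e -> Q e c -> ubound L (h c + 16 * e).
  move=> e0 Qc _ [e' [c' [e'0 Qc' ->]]].
  by have := hQ _ _ _ _ e'0 e0 Qc' Qc; lra.
have [c1 Q1] := Q_ex ltr01.
have L0 : L !=set0 by exists (h c1 - 16 * 1), 1, c1; split.
have supL : has_sup L by split => //; exists (h c1 + 16 * 1); exact: ubL.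
exists (sup L) => e c e0 Qc; rewrite ler_norml; apply/andP; split.
  have := ge_sup L0 (ubL _ _ e0 Qc); lra.
have : L (h c - 16 * e) by exists e, c.
by move/(sup_upper_bound supL); lra.
Qed.

Lemma complex_limit :
  (forall e e' c c', 0 < e -> 0 < e' -> Q e c -> Q e' c' ->
    normc (c - c') <= 16 * (e + e')) ->
  exists c0, forall e c, 0 < e -> Q e c -> normc (c - c0) <= 32 * e.
Proof.
move=> hQ.
have [a ha] : exists r, forall e c, 0 < e -> Q e c -> `|complex.Re c - r| <=
  16 * e.
  apply: real_limit => e e' c c' e0 e'0 Qc Qc'.
  apply: le_trans (hQ _ _ _ _ e0 e'0 Qc Qc').
  apply: le_trans (normr_Re_le _); apply: le_trans (ler_norm _).
  by case: (c) (c') => [? ?] [].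
have [b hb] : exists r, forall e c, 0 < e -> Q e c -> `|complex.Im c - r| <=
  16 * e.
  apply: real_limit => e e' c c' e0 e'0 Qc Qc'.
  apply: le_trans (hQ _ _ _ _ e0 e'0 Qc Qc').
  apply: le_trans (normr_Im_le _); apply: le_trans (ler_norm _).
  by case: (c) (c') => [? ?] [].
(* Errors of 16 e in each coordinate give at most sqrt 2 times 16 e, hence 32 e. *)
exists (a +i* b) => e c e0 Qc.
have := ha _ _ e0 Qc; have := hb _ _ e0 Qc.
case: c {Qc} => x y /= hy hx.
rewrite -(ler_pXn2r (n := 2)) ?nnegrE ?sqrtr_ge0 ?mulr_ge0 ?(ltW e0) //.
rewrite sqr_sqrtr ?addr_ge0 ?sqr_ge0 //.
have x2 : (x - a) ^+ 2 <= (16 * e) ^+ 2.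
  by rewrite -real_normK ?num_real // ler_pXn2r ?nnegrE ?mulr_ge0 ?(ltW e0).
have y2 : (y - b) ^+ 2 <= (16 * e) ^+ 2.
  by rewrite -real_normK ?num_real // ler_pXn2r ?nnegrE ?mulr_ge0 ?(ltW e0).
by move: x2 y2; nra.
Qed.

End ComplexLimit.

(** * The algebra of operators with the box vectors as approximate eigenvectors *)

Section ApproximateEigenvalues.
Context {R : realType} (w : R[i] * R[i]) (tw : torus w).
Local Notation C := R[i].
Local Notation v := (box_vector w).
Implicit Types (S T : l2 R -> l2 R) (c d : C).

(** Since [v n] has norm n, the bound [e * n%:R] is a relative error e. *)
Definition approx_eigenvalue T c : Prop := is_bounded_op T /\
  forall e, 0 < e -> exists N, forall n, (N <= n)%N ->
    l2norm (T (v n) - c *: v n) <= e * n%:R.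

Lemma bounded_opW T : is_bounded_op T ->
  exists2 M, 0 <= M & forall x, l2norm (T x) <= M * l2norm x.
Proof.
case=> _ [M TM]; exists `|M| => // x; apply: le_trans (TM x) _.
by rewrite ler_wpM2r ?l2norm_ge0 ?ler_norm.
Qed.

Lemma approx_eigenvalueW T c K : is_bounded_op T -> 0 <= K ->
  (forall e, 0 < e -> exists N, forall n, (N <= n)%N ->
    l2norm (T (v n) - c *: v n) <= K * (e * n%:R)) ->
  approx_eigenvalue T c.
Proof.
move=> bT K0 TK; split => // e e0.
(* Dividing by K + 1 rather than K allows K = 0. *)
have K1 : 0 < K + 1 by rewrite ltr_wpDl.
have [N hN] := TK (e / (K + 1)) (divr_gt0 e0 K1).
exists N => n /hN /le_trans; apply.
rewrite mulrA ler_wpM2r // mulrCA -[leRHS]mulr1 ler_wpM2l ?(ltW e0) //.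
by rewrite ler_pdivrMr // mul1r lerDl.
Qed.

Lemma approx_eigenvalue_id : approx_eigenvalue id 1.
Proof.
split => [|e e0]; first by split => //; exists 1 => x; rewrite mul1r.
exists 0%N => n _; rewrite scale1r subrr -[0](scale0r 0) l2normZ /=.
by rewrite expr0n /= addr0 sqrtr0 mul0r mulr_ge0 ?(ltW e0).
Qed.

Lemma bounded_op_lin a S T : is_bounded_op S -> is_bounded_op T ->
  is_bounded_op (fun x => a *: S x + T x).
Proof.
move=> bS bT; split.
  move=> b x y; rewrite bS.1 bT.1 !scalerDr !scalerA (mulrC a b).
  by rewrite -!addrA; congr (_ + _); rewrite addrCA.
have [M M0 hM] := bounded_opW bS; have [M' M'0 hM'] := bounded_opW bT.
exists (2 * (normc a * M + M')) => x.
apply: le_trans (l2norm_quasi_triangle _ _) _.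
rewrite -mulrA ler_wpM2l // mulrDl; apply: lerD; last exact: hM'.
by rewrite l2normZ -mulrA; apply: ler_wpM2l; [exact: normc_ge0|exact: hM].
Qed.

Lemma bounded_op_comp S T : is_bounded_op S -> is_bounded_op T ->
  is_bounded_op (S \o T).
Proof.
move=> bS bT; split; first by move=> b x y; rewrite /= bT.1 bS.1.
have [M M0 hM] := bounded_opW bS; have [M' M'0 hM'] := bounded_opW bT.
exists (M * M') => x; apply: le_trans (hM _) _.
by rewrite -mulrA; apply: ler_wpM2l; [exact: M0|exact: hM'].
Qed.

Lemma approx_eigenvalue_lin a S T c d :
  approx_eigenvalue S c -> approx_eigenvalue T d ->
  approx_eigenvalue (fun x => a *: S x + T x) (a * c + d).
Proof.
move=> [bS hS] [bT hT].
apply: (@approx_eigenvalueW _ _ (2 * (normc a + 1))).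
- exact: bounded_op_lin.
- by rewrite mulr_ge0 // addr_ge0 ?normc_ge0.
move=> e e0; have [N hN] := hS _ e0; have [N' hN'] := hT _ e0.
exists (maxn N N') => n; rewrite geq_max => /andP[/hN hn /hN' hn'].
have -> : a *: S (v n) + T (v n) - (a * c + d) *: v n =
    a *: (S (v n) - c *: v n) + (T (v n) - d *: v n).
  by rewrite scalerBr scalerA scalerDl opprD addrACA.
apply: le_trans (l2norm_quasi_triangle _ _) _.
rewrite -mulrA ler_wpM2l // mulrDl mul1r; apply: lerD; last exact: hn'.
by rewrite l2normZ; apply: ler_wpM2l; [exact: normc_ge0|exact: hn].
Qed.

Lemma approx_eigenvalue_comp S T c d :
  approx_eigenvalue S c -> approx_eigenvalue T d ->
  approx_eigenvalue (S \o T) (c * d).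
Proof.
move=> [bS hS] [bT hT]; have [M M0 hM] := bounded_opW bS.
apply: (@approx_eigenvalueW _ _ (2 * (M + normc d))).
- exact: bounded_op_comp.
- by rewrite mulr_ge0 // addr_ge0 ?normc_ge0.
move=> e e0; have [N hN] := hS _ e0; have [N' hN'] := hT _ e0.
exists (maxn N N') => n; rewrite geq_max => /andP[/hN hn /hN' hn'].
have linS x y : S (x - d *: y) = S x - d *: S y.
  by rewrite addrC -scaleNr bS.1 scaleNr addrC.
have -> : (S \o T) (v n) - (c * d) *: v n =
    S (T (v n) - d *: v n) + d *: (S (v n) - c *: v n).
  by rewrite linS scalerBr scalerA (mulrC c) addrA subrK.
apply: le_trans (l2norm_quasi_triangle _ _) _.
rewrite -mulrA ler_wpM2l // mulrDl; apply: lerD.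
  by apply: le_trans (hM _) _; apply: ler_wpM2l; [exact: M0|exact: hn'].
by rewrite l2normZ; apply: ler_wpM2l; [exact: normc_ge0|exact: hn].
Qed.

(** Evaluated on a box vector, (c - d) v differs from (S - T) v by the two eigenvector errors. With
    these taken at e / 2, two uses of [l2norm_quasi_triangle] give 2 (e + 2 e) = 6 e, within the
    stated 8 e. *)
Lemma approx_eigenvalue_close S T c d e : approx_eigenvalue S c ->
  approx_eigenvalue T d -> 0 < e ->
  (forall x, l2norm (S x - T x) <= e * l2norm x) -> normc (c - d) <= 8 * e.
Proof.
move=> [_ hS] [_ hT] e0 ST.
have e20 : 0 < e / 2 by rewrite divr_gt0.
have [N hN] := hS _ e20; have [N' hN'] := hT _ e20.
(* The successor keeps n positive, so that the norm of the box vector can be cancelled. *)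
pose n := (maxn N N').+1.
have /hN hn : (N <= n)%N by rewrite ltnW // ltnS leq_maxl.
have /hN' hn' : (N' <= n)%N by rewrite ltnW // ltnS leq_maxr.
have n0 : 0 < n%:R :> R by rewrite ltr0n.
rewrite -(ler_pM2r n0) -{1}(l2norm_box tw n) -l2normZ.
rewrite scalerBl -(subr_tele (S (v n)) (T (v n))).
apply: le_trans (l2norm_quasi_triangle _ _) _.
have h1 : l2norm (S (v n) - T (v n)) <= e * n%:R.
  by rewrite -(l2norm_box tw n); exact: ST.
have h2 : l2norm ((T (v n) - d *: v n) - (S (v n) - c *: v n)) <=
  2 * (e * n%:R).
  apply: le_trans (l2norm_quasi_triangle _ _) _; rewrite l2normN.
  rewrite ler_pM2l // (splitr e) mulrDl; apply: lerD; [exact: hn'|exact: hn].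
move: (lerD h1 h2) n0; move: (l2norm _ + _) => p; move: (n%:R) => m; clear -e0;
  nra.
Qed.

Lemma approx_eigenvalue_uniq T c d :
  approx_eigenvalue T c -> approx_eigenvalue T d -> c = d.
Proof.
move=> Tc Td; apply/eqP; rewrite -subr_eq0; apply/eqP/eq0_normc.
apply/eqP; rewrite eq_le normc_ge0 andbT; apply/ler_addgt0Pl => e e0.
rewrite addr0.
have e8 : 0 < e / 8 by rewrite divr_gt0.
have := approx_eigenvalue_close Tc Td e8; rewrite [8 * _]mulrC divfK ?pnatr_eq0
  //; apply => x.
rewrite subrr -[0](scale0r 0) l2normZ /= expr0n /= addr0 sqrtr0 mul0r.
by rewrite mulr_ge0 ?l2norm_ge0 ?(ltW e8).
Qed.

(** By [approx_eigenvalue_close], the eigenvalues of ever better approximations of [T] cluster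
    around one number, which is the eigenvalue of [T]. *)
Lemma approx_eigenvalue_limit T : is_bounded_op T ->
  (forall e, 0 < e -> exists S, (exists c, approx_eigenvalue S c) /\
    forall x, l2norm (T x - S x) <= e * l2norm x) ->
  exists c, approx_eigenvalue T c.
Proof.
move=> bT hT.
pose Q e c := exists2 S, approx_eigenvalue S c &
  forall x, l2norm (T x - S x) <= e * l2norm x.
have [c0 hc0] : exists c0, forall e c, 0 < e -> Q e c -> normc (c - c0) <=
  32 * e.
  apply: complex_limit => [e /hT[S [[c Sc] TS]]|e e' c c' e0 e'0].
    by exists c, S.
  move=> [S Sc TS] [S' Sc' TS'].
  have -> : 16 * (e + e') = 8 * (2 * (e + e')) by lra.
  apply: (approx_eigenvalue_close Sc Sc'); first by rewrite mulr_gt0 ?addr_gt0.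
  move=> x; have -> : S x - S' x = (T x - S' x) + - (T x - S x).
    by rewrite opprB [RHS]addrC subrKA.
  apply: le_trans (l2norm_quasi_triangle _ _) _; rewrite l2normN.
  rewrite -mulrA ler_pM2l // addrC mulrDl; apply: lerD; [exact: TS|exact: TS'].
(* Errors e, e and 32 e, combined by two uses of [l2norm_quasi_triangle]: 2 (1 + 2 (1 + 32)) =
   134. *)
exists c0; apply: (@approx_eigenvalueW _ _ 134) => // e e0.
have [S [[c Sc] TS]] := hT _ e0; have [_ /(_ _ e0)[N hN]] := Sc.
exists N => n /hN hn.
have h1 : l2norm (T (v n) - S (v n)) <= e * n%:R.
  by rewrite -(l2norm_box tw n); exact: TS.
have h2 : l2norm ((c - c0) *: v n) <= 32 * (e * n%:R).
  rewrite l2normZ (l2norm_box tw) mulrA ler_wpM2r //.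
  by apply: hc0 => //; exists S.
have -> : T (v n) - c0 *: v n =
    (T (v n) - S (v n)) + ((S (v n) - c *: v n) + (c - c0) *: v n).
  by rewrite scalerBl subrKA subrKA.
apply: le_trans (l2norm_quasi_triangle _ _) _.
have h3 := l2norm_quasi_triangle (S (v n) - c *: v n) ((c - c0) *: v n).
move: (l2norm _) (l2norm _) (l2norm _) (l2norm _) h1 h2 h3 hn => p q r s.
clear; lra.
Qed.

End ApproximateEigenvalues.

(** * Values of the chi on the torus belong to the joint spectrum *)

Section JointSpectrum.
Context {R : realType} (w : R[i] * R[i]) (tw : torus w).
Local Notation C := R[i].
Local Notation v := (box_vector w).
Implicit Types (S T : l2 R -> l2 R) (c d : C).

Lemma shift_bounded k : is_bounded_op (@Defs.shift R k).
Proof.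
split; first exact: l2shift_is_linear.
by exists 1 => x; rewrite mul1r l2norm_shift.
Qed.

Lemma approx_eigenvalue_unit_shift k :
  (forall n, l2norm (Defs.shift k (v n) - sig k w *: v n) ^+ 2 <= 16 * n%:R) ->
  approx_eigenvalue w (Defs.shift k) (sig k w).
Proof.
move=> hk; split; first exact: shift_bounded.
move=> e e0; have e2 : 0 < e ^+ 2 by rewrite exprn_gt0.
have b0 : 0 <= 16 / e ^+ 2 by rewrite divr_ge0 ?ltW.
(* The squared error 16 n is at most (e n)^2 as soon as n is at least 16 / e^2. *)
exists (Num.bound (16 / e ^+ 2)) => n Nn.
rewrite -(ler_pXn2r (n := 2)) ?nnegrE ?l2norm_ge0 ?mulr_ge0 ?(ltW e0) //.
apply: le_trans (hk n) _; rewrite exprMn [n%:R ^+ 2]expr2 mulrA ler_wpM2r //.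
rewrite mulrC -ler_pdivrMr //.
by apply: le_trans (ltW (archi_boundP b0)) _; rewrite ler_nat.
Qed.

Lemma approx_eigenvalue_shiftN k :
  approx_eigenvalue w (Defs.shift k) (sig k w) ->
  approx_eigenvalue w (Defs.shift (- k)) (sig (- k) w).
Proof.
move=> [bk hk]; split; first exact: shift_bounded.
have uk : sig (- k) w * sig k w = 1 by rewrite -sigD // addNr sig0.
have shB x : Defs.shift (- k) (Defs.shift k x - sig k w *: x) =
    x - sig k w *: Defs.shift (- k) x.
  by rewrite addrC -scaleNr l2shift_is_linear -l2shiftD addNr l2shift0 scaleNr
    addrC.
have E x : l2norm (Defs.shift (- k) x - sig (- k) w *: x) =
    l2norm (Defs.shift k x - sig k w *: x).
  rewrite -(l2norm_shift (- k) (Defs.shift k x - _)) shB -[RHS]mul1r.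
  rewrite -(sig_circle (- k) tw) -normcN -l2normZ scaleNr scalerBr scalerA uk.
  by rewrite scale1r opprB.
by move=> e /hk[N hN]; exists N => n Nn; rewrite E; exact: hN.
Qed.

Lemma approx_eigenvalue_shiftD k l :
  approx_eigenvalue w (Defs.shift k) (sig k w) ->
  approx_eigenvalue w (Defs.shift l) (sig l w) ->
  approx_eigenvalue w (Defs.shift (k + l)) (sig (k + l) w).
Proof.
move=> hk hl; rewrite (sigD _ _ tw).
have -> : @Defs.shift R (k + l) = Defs.shift k \o Defs.shift l.
  by apply/funext => x; rewrite l2shiftD.
exact: approx_eigenvalue_comp.
Qed.

Lemma wtMz (a b z : int) : wt a b *~ z = wt (a *~ z) (b *~ z).
Proof.
have wtMn n : wt a b *+ n = wt (a *+ n) (b *+ n).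
  by apply/rowP => j; rewrite mulmxnE !mxE; case: ifP.
have wtN (x y : int) : - wt x y = wt (- x) (- y).
  by apply/rowP => j; rewrite !mxE; case: ifP.
by case: z => n; rewrite ?NegzE ?mulrNz -!pmulrn wtMn ?wtN.
Qed.

Lemma approx_eigenvalue_shift k : approx_eigenvalue w (Defs.shift k) (sig k w).
Proof.
have h0 : approx_eigenvalue w (Defs.shift 0) (sig 0 w).
  rewrite sig0 (_ : Defs.shift 0 = id); first exact: approx_eigenvalue_id.
  by apply/funext => x; rewrite l2shift0.
have hZ (l : weight) (z : int) : approx_eigenvalue w (Defs.shift l) (sig l w) ->
    approx_eigenvalue w (Defs.shift (l *~ z)) (sig (l *~ z) w).
  move=> hl; have hn (n : nat) :
      approx_eigenvalue w (Defs.shift (l *+ n)) (sig (l *+ n) w).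
    elim: n => [|n IH]; first by rewrite mulr0n; exact: h0.
    by rewrite mulrS; exact: approx_eigenvalue_shiftD hl IH.
  case: z => n; first by rewrite -pmulrn; exact: hn.
  by rewrite NegzE mulrNz -pmulrn; exact: approx_eigenvalue_shiftN (hn _).
have -> : k = wt 1 0 *~ k 0 0 + wt 0 1 *~ k 0 1.
  by rewrite !wtMz wtD !mul0rz !intz addr0 add0r -wtE.
apply: approx_eigenvalue_shiftD; apply: hZ; apply: approx_eigenvalue_unit_shift.
  by move=> n; exact: box_vector_shift1.
by move=> n; exact: box_vector_shift2.
Qed.

Lemma approx_eigenvalue_sum (s : seq weight) (a : weight -> C)
  (h : weight -> weight) :
  approx_eigenvalue w (fun x => \sum_(k <- s) a k *: Defs.shift (h k) x)
    (\sum_(k <- s) a k * sig (h k) w).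
Proof.
elim: s => [|k s IH].
  (* The zero operator is obtained as -1 times the identity plus the identity. *)
  rewrite big_nil; have := approx_eigenvalue_lin (-1) (approx_eigenvalue_id w)
    (approx_eigenvalue_id w).
  rewrite mulr1 addNr; congr approx_eigenvalue; apply/funext => x.
  by rewrite big_nil scaleN1r addNr.
rewrite big_cons; have :=
  approx_eigenvalue_lin (a k) (approx_eigenvalue_shift (h k)) IH.
by congr approx_eigenvalue; apply/funext => x; rewrite big_cons.
Qed.

Lemma approx_eigenvalue_adjacency G l :
  approx_eigenvalue w (adjacency (edges R G l)) (leval (chi R G l) w).
Proof.
have := approx_eigenvalue_sum (finsupp (chi R G l)) (fun k => (chi R G l k)%:R)
  id.
by congr approx_eigenvalue; apply/funext => x; rewrite adjacencyE.
Qed.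

Lemma approx_eigenvalue_adjacency_tr G l :
  approx_eigenvalue w (adjacency (transpose (edges R G l)))
    (conjc (leval (chi R G l) w)).
Proof.
have := approx_eigenvalue_sum (finsupp (chi R G l)) (fun k => (chi R G l k)%:R)
  -%R.
rewrite (conjc_leval _ tw).
by congr approx_eigenvalue; apply/funext => x; rewrite adjacency_trE.
Qed.

Lemma csum_delta (s : seq weight) (a : weight -> C) (h : weight -> weight)
    (g : weight -> C) :
  csum (fun nu => (\sum_(k <- s) a k * (nu == h k)%:R) * g nu) =
  \sum_(k <- s) a k * g (h k).
Proof.
(* [h] may take a value twice, hence the removal of duplicates from the support. *)
rewrite (@csum_seq _ _ (undup (map h s))) ?undup_uniq //; last first.
  move=> nu; rewrite mem_undup => nus; rewrite big_seq big1 ?mul0r // => k ks.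
  case: eqVneq => [E|_]; last by rewrite mulr0.
  by move: nus; rewrite E map_f.
under eq_bigr do rewrite mulr_suml.
rewrite exchange_big /= big_seq [RHS]big_seq; apply: eq_bigr => k ks.
rewrite (bigD1_seq (h k)) ?undup_uniq ?mem_undup ?map_f //= eqxx mulr1.
by rewrite big1 ?addr0 // => nu /negbTE ->; rewrite mulr0 mul0r.
Qed.

(** The C*-algebra is generated with every map satisfying the adjoint relation, so these must be
    identified. Testing the relation on the basis vector at mu recovers the coefficient of [T y] at
    mu. *)
Lemma adjacency_adjoint G l T : is_adjoint (adjacency (edges R G l)) T ->
  T = adjacency (transpose (edges R G l)).
Proof.
move=> adj; apply/funext => y; apply: l2P => mu.
have conjM (n : nat) (z : C) : conjc (n%:R * conjc z) = n%:R * z.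
  by rewrite rmorphM /= conjc_nat conjcK.
have shE k nu : Defs.shift k (@vacuum R) nu = (nu == k)%:R.
  by rewrite -[LHS]/(@vacuum R (nu - k)) vacuumE subr_eq0.
have := adj (Defs.shift mu (@vacuum R)) y.
rewrite (adjacencyE G l (Defs.shift mu _)) /inner.
rewrite [X in _ = X -> _](@csum_supp1 _ _ mu); last first.
  by move=> nu /negbTE numu; rewrite shE numu mul0r.
rewrite shE eqxx mul1r => E.
rewrite adjacency_trE l2_sumE -[LHS]conjcK -[X in conjc X = _]E.
under [X in csum X]eq_fun.
  move=> nu; rewrite l2_sumE.
  under eq_bigr do rewrite l2Z_apply -l2shiftD shE.
  over.
rewrite (csum_delta (finsupp (chi R G l)) (fun k => (chi R G l k)%:R)
  (fun k => k + mu) (fun nu => conjc (y nu))).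
rewrite rmorph_sum; apply: eq_bigr => k _.
rewrite l2Z_apply -[Defs.shift _ _ _]/(y (mu - - k)) opprK addrC.
exact: conjM.
Qed.

Lemma approx_eigenvalue_cstar (F : set (l2 R -> l2 R)) T :
  (forall S, F S -> exists c, approx_eigenvalue w S c) ->
  (forall S T, F S -> is_adjoint S T -> exists c, approx_eigenvalue w T c) ->
  cstar_algebra F T -> exists c, approx_eigenvalue w T c.
Proof.
move=> hF hF'.
suff : cstar_algebra F `<=` [set T | exists c, approx_eigenvalue w T c]
  by apply.
apply: smallest_sub.
  split.
  - by exists 1; exact: approx_eigenvalue_id.
  - move=> a S S' [c Sc] [d Sd]; exists (a * c + d).
    exact: approx_eigenvalue_lin.
  - move=> S S' [c Sc] [d Sd]; exists (c * d).
    exact: approx_eigenvalue_comp.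
  - exact: approx_eigenvalue_limit.
move=> S [/hF//|[S' FS' adj]]; exact: hF' adj.
Qed.

Lemma joint_spectrum_chi_pair G :
  joint_spectrum (adjacency (edges R G (rho1 G)))
    (adjacency (edges R G (rho2 G)))
    (chi_pair G w).
Proof.
rewrite /joint_spectrum /=; set A := cstar_algebra _.
(* The character of the algebra: the approximate eigenvalue at w, unique by
   [approx_eigenvalue_uniq]. On the algebra it exists, so the default 0 is not reached there. *)
pose ev T := xget 0 [set c | approx_eigenvalue w T c].
have evE T c : approx_eigenvalue w T c -> ev T = c.
  move=> Tc; apply: (approx_eigenvalue_uniq tw _ Tc).
  exact: (xgetPex 0 (ex_intro _ c Tc : exists c,
    [set c | approx_eigenvalue w T c] c)).
have Aev T : A T -> approx_eigenvalue w T (ev T).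
  move=> AT; suff [c Tc] : exists c, approx_eigenvalue w T c
    by rewrite (evE _ _ Tc).
  refine (approx_eigenvalue_cstar _ _ AT).
    move=> S [->|->]; eexists;
      first exact: (approx_eigenvalue_adjacency G (rho1 G)).
    exact: (approx_eigenvalue_adjacency G (rho2 G)).
  move=> S T' [->|->] /adjacency_adjoint ->; eexists.
    exact: (approx_eigenvalue_adjacency_tr G (rho1 G)).
  exact: (approx_eigenvalue_adjacency_tr G (rho2 G)).
exists ev; split; last first.
  by rewrite /chi_pair; congr pair; apply/esym/evE;
    exact: approx_eigenvalue_adjacency.
split.
- exact/evE/approx_eigenvalue_id.
- by move=> a S T /Aev hS /Aev hT; apply: evE;
    exact: (approx_eigenvalue_lin a hS hT).
- by move=> S T /Aev hS /Aev hT; apply: evE;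
    exact: (approx_eigenvalue_comp hS hT).
Qed.

End JointSpectrum.

Theorem theorem3p1 (R : realType) (G : group_name) :
  is_joint_spectral_measure_over_torus G (haar2 R) /\
  forall m1 n1 m2 n2 : nat,
    cross_moment R (edges R G (rho1 G)) (edges R G (rho2 G)) m1 n1 m2 n2 =
    cintegral (haar2 R) (fun w : R[i] * R[i] =>
      leval (chi R G (rho1 G)) w ^+ m1 *
      conjc (leval (chi R G (rho1 G)) w) ^+ n1 *
      leval (chi R G (rho2 G)) w ^+ m2 *
      conjc (leval (chi R G (rho2 G)) w) ^+ n2).
Proof.
split; last by move=> m1 n1 m2 n2; exact: cross_momentE.
split.
- exact: haar2_torus.
- by move=> g /Gamma_unit ug B mB; exact: haar2_act.
pose f : {mfun (R[i] * R[i])%type >-> (R[i] * R[i])%type} :=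
  HB.pack (@chi_pair R G)
    (@isMeasurableFun.Build _ _ _ _ _ (measurable_chi_pair G)).
exists (distribution (haar2 R) f); split => //.
split.
  (* The preimage of the joint spectrum under [chi_pair] contains the torus. *)
  by apply: haar2_torus => w tw; exact: joint_spectrum_chi_pair.
move=> m1 n1 m2 n2; rewrite cross_momentE.
have tm : trig (@chi_moment R G m1 n1 m2 n2).
  split; first exact: measurable_chi_moment.
  by have [s [_ hs]] := @chi_moment_symbol R G m1 n1 m2 n2; exists s.
by rewrite (cintegral_image (measurable_chi_pair G)
  (measurable_monomial _ _ _ _) _ tm).
Qed.
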